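(* Let $\Omega$ be a complete separable metric space, $\hat{\mathbb{E}}$ a regular sublinear expectation on $\mathcal{H}=C_{b.Lip}(\Omega)$ (extended to $L^1(\Omega)$), and let $\mathcal{P}$ be a convex and weakly compact set of probability measures on $(\Omega,\mathcal{B}(\Omega))$ such that $\hat{\mathbb{E}}[X]=\sup_{P\in\mathcal{P}}E_P[X]$ for all $X\in\mathcal{H}$. Let $d\ge 1$, $n>1$, and let $\{X_i\}_{i=1}^n$ be an independent sequence of random vectors in $L^2(\Omega;\mathbb{R}^d)$ under $\hat{\mathbb{E}}$. For $i\le n$ set $$\Theta_i=\{\theta\in\mathbb{R}^d:\langle\theta,p\rangle\le\hat{\mathbb{E}}[\langle p,X_i\rangle]\text{ for all }p\in\mathbb{R}^d\}.$$ Then: (1) $\Theta_i=\{E_P[X_i]:P\in\mathcal{P}\}$ for every $i\le n$. (2) For each $P\in\mathcal{P}$ and each $i\le n$, $E_P[X_i\mid\mathcal{F}_{i-1}]\in\Theta_i$, $P$-a.s., where $\mathcal{F}_i=\sigma(X_1,\ldots,X_i)$ for $i\ge1$ and $\mathcal{F}_0=\{\emptyset,\Omega\}$.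
   Context: Setting. $\Omega$ is a complete separable metric space with Borel $\sigma$-field $\mathcal{B}(\Omega)$; $\mathcal{H}=C_{b.Lip}(\Omega)$ is the space of bounded Lipschitz real functions on $\Omega$. A functional $\hat{\mathbb{E}}:\mathcal{H}\to\mathbb{R}$ is a regular sublinear expectation if for $X,Y,X_n\in\mathcal{H}$: (i) $X\ge Y$ implies $\hat{\mathbb{E}}[X]\ge\hat{\mathbb{E}}[Y]$; (ii) $\hat{\mathbb{E}}[c]=c$ for $c\in\mathbb{R}$; (iii) $\hat{\mathbb{E}}[X+Y]\le\hat{\mathbb{E}}[X]+\hat{\mathbb{E}}[Y]$; (iv) $\hat{\mathbb{E}}[\lambda X]=\lambda\hat{\mathbb{E}}[X]$ for $\lambda\ge0$; (v) $X_n\downarrow0$ implies $\hat{\mathbb{E}}[X_n]\downarrow0$. It is a known fact (representation theorem) that there exists a convex and weakly compact set $\mathcal{P}$ of probability measures on $(\Omega,\mathcal{B}(\Omega))$ with $\hat{\mathbb{E}}[X]=\sup_{P\in\mathcal{P}}E_P[X]$ for $X\in\mathcal{H}$. For $p\ge1$, $L^p(\Omega)$ is the completion of $\mathcal{H}$ under the norm $\|X\|_p=(\hat{\mathbb{E}}[|X|^p])^{1/p}$; $L^p(\Omega)\subset L^1(\Omega)$, $\hat{\mathbb{E}}$ extends continuously to $L^1(\Omega)$, and the representation $\hat{\mathbb{E}}[X]=\sup_{P\in\mathcal{P}}E_P[X]$ still holds for $X\in L^1(\Omega)$. As usual, elements of $L^p(\Omega)$ are regarded as random variables on $\Omega$,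 identified when they agree outside a set that is null under every $P\in\mathcal{P}$. $L^p(\Omega;\mathbb{R}^d)$ is the set of random vectors $X=(X^1,\ldots,X^d)^T$ with every $X^j\in L^p(\Omega)$. Independence. $C_{b.Lip}(\mathbb{R}^m)$ is the space of bounded Lipschitz functions on $\mathbb{R}^m$. $Y\in L^1(\Omega;\mathbb{R}^{d_2})$ is independent of $X\in L^1(\Omega;\mathbb{R}^{d_1})$ if for each $\psi\in C_{b.Lip}(\mathbb{R}^{d_1+d_2})$, $\hat{\mathbb{E}}[\psi(X,Y)]=\hat{\mathbb{E}}\big[\hat{\mathbb{E}}[\psi(x,Y)]_{x=X}\big]$. A sequence $\{X_i\}_{i=1}^n\subset L^1(\Omega;\mathbb{R}^d)$, $n>1$, is independent if $X_{i+1}$ is independent of $(X_1,\ldots,X_i)$ for $1\le i\le n-1$ (this notion is not symmetric). $E_P$ denotes (conditional) expectation under $P$, taken componentwise for vectors; $\langle\cdot,\cdot\rangle$ is the Euclidean inner product. *)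

(* Defs.v *)
From HB Require Import structures.
From mathcomp Require Import all_boot all_order all_algebra.
From mathcomp Require Import all_classical all_reals all_analysis.

Set Implicit Arguments.
Unset Strict Implicit.
Unset Printing Implicit Defensive.

Import Order.TTheory GRing.Theory Num.Theory.
Import numFieldTopology.Exports numFieldNormedType.Exports.

Local Open Scope classical_set_scope.
Local Open Scope ring_scope.

(* [Complete] brings in a distinguished point; a space that carries a sublinear
   expectation is nonempty anyway. *)
#[short(type="completeMetricType")]
HB.structure Definition CompleteMetric (R : numDomainType) :=
  {T of Complete T & Metric R T}.

Definition separable (T : topologicalType) :=
  exists D : set T, countable D /\ dense D.

Notation borel T := (g_sigma_algebraType (@open T)).

Definition bounded_lipschitz (R : realType) (T : Type) (dist : T -> T -> R)
    (f : T -> R) :=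
  (exists M, forall x, `|f x| <= M) /\
  (exists k, forall x y, `|f x - f y| <= k * dist x y).

Definition dotp (R : realType) (m : nat) (x y : 'rV[R]_m) : R :=
  \sum_(j < m) x ord0 j * y ord0 j.

Definition euclidean_dist (R : realType) (m : nat) (x y : 'rV[R]_m) : R :=
  Num.sqrt (dotp (x - y) (x - y)).

Definition CbLip (R : realType) (Omega : metricType R) : set (Omega -> R) :=
  [set f | bounded_lipschitz (@mdist R Omega) f].
Arguments CbLip {R} Omega _.

Definition CbLip_rV (R : realType) (m : nat) : set ('rV[R]_m -> R) :=
  [set f | bounded_lipschitz (@euclidean_dist R m) f].

(* Only the values of [E] on [CbLip Omega] are constrained here. *)
Record regular_sublinear (R : realType) (Omega : metricType R)
    (E : (Omega -> R) -> R) : Prop := RegularSublinear {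
  sublin_monotone : forall X Y, CbLip Omega X -> CbLip Omega Y ->
    (forall w, Y w <= X w) -> E Y <= E X ;
  sublin_cst : forall c : R, E (fun=> c) = c ;
  sublin_subadditive : forall X Y, CbLip Omega X -> CbLip Omega Y ->
    E (fun w => X w + Y w) <= E X + E Y ;
  sublin_homogeneous : forall (l : R) X, CbLip Omega X -> 0 <= l ->
    E (fun w => l * X w) = l * E X ;
  sublin_regular : forall X : nat -> Omega -> R,
    (forall k, CbLip Omega (X k)) ->
    (forall w, nonincreasing_seq (fun k => X k w)) ->
    (forall w, X k w @[k --> \oo] --> (0 : R)) ->
    nonincreasing_seq (fun k => E (X k)) /\
    E (X k) @[k --> \oo] --> (0 : R)
}.

Section probability_sets.
Context (R : realType) (Omega : completeMetricType R).
Implicit Type PP : set (probability (borel Omega) R).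

Definition bounded_continuous :=
  {f : Omega -> R | continuous f /\ exists M, forall x, `|f x| <= M}.

(* The topology of weak convergence is the coarsest one that makes
   P |-> E_P[f] continuous for every bounded continuous f. *)
Definition weak_eval (P : probability (borel Omega) R) :
    {ptws bounded_continuous -> R} :=
  fun f => fine ('E_P[sval f])%E.

Definition weakly_compact PP := @compact (initial_topology weak_eval) PP.

(* The mixture is compared on Borel sets only: a library measure also takes
   (meaningless) values on non-measurable sets. *)
Definition convex_set_of_probabilities PP :=
  forall (P Q : probability (borel Omega) R) (t : R),
    PP P -> PP Q -> 0 <= t <= 1 ->
    exists2 S, PP S & forall A : set (borel Omega), measurable A ->
      S A = (t%:E * P A + (1 - t)%:E * Q A)%E.

Definition upper_expectation PP (X : Omega -> R) : \bar R :=
  ereal_sup [set ('E_P[X])%E | P in PP].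

(* The norm ||X||_p, written with the representation of the sublinear
   expectation so that it makes sense for any random variable X. *)
Definition Lp_norm PP (p : R) (X : Omega -> R) : \bar R :=
  (upper_expectation PP (fun w => (`|X w| `^ p)%R) `^ p^-1)%E.

Definition Lp_approx PP (p : R) (X : Omega -> R) (u : nat -> Omega -> R) :=
  (forall k, CbLip Omega (u k)) /\
  Lp_norm PP p (fun w => u k w - X w) @[k --> \oo] --> (0 : \bar R).

(* The completion of [CbLip Omega] for [Lp_norm PP p], realised as the Borel
   random variables that are limits of elements of [CbLip Omega]; its elements
   are thus representatives of quasi-sure equivalence classes. *)
Definition Lp PP (p : R) : set (Omega -> R) :=
  [set X | measurable_fun [set: borel Omega] X /\
           exists u, Lp_approx PP p X u].

Definition Lp_rV PP (p : R) (m : nat) : set (Omega -> 'rV[R]_m) :=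
  [set X | forall j, Lp PP p (fun w => X w ord0 j)].

(* [E], given on [CbLip Omega], takes on L^1 the values of its continuous
   extension. *)
Definition L1_extended PP (E : (Omega -> R) -> R) :=
  forall X u, Lp PP 1 X -> Lp_approx PP 1 X u -> E (u k) @[k --> \oo] --> E X.

End probability_sets.

Section independence.
Context (R : realType) (Omega : Type).
Implicit Type E : (Omega -> R) -> R.

Definition independent_of E (d1 d2 : nat)
    (Y : Omega -> 'rV[R]_d2) (X : Omega -> 'rV[R]_d1) :=
  forall psi : 'rV[R]_(d1 + d2) -> R, CbLip_rV psi ->
    E (fun w => psi (row_mx (X w) (Y w))) =
    E (fun w => E (fun w' => psi (row_mx (X w) (Y w')))).

(* The sequence X_1, ..., X_n is indexed by 'I_n, so that [X i] is X_{i+1} and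
   [past X i] is (X_1, ..., X_i) seen as a vector of R^{i d}. *)
Definition past (d n : nat) (X : 'I_n -> Omega -> 'rV[R]_d) (i : 'I_n)
    (w : Omega) : 'rV[R]_(i * d) :=
  mxvec (\matrix_(k < i) X (widen_ord (ltnW (ltn_ord i)) k) w).

Definition independent_sequence E (d n : nat)
    (X : 'I_n -> Omega -> 'rV[R]_d) :=
  forall i : 'I_n, (0 < i)%N -> independent_of E (X i) (past X i).

(* sigma(X_1, ..., X_i), which is {set0, setT} for i = 0. *)
Definition past_sigma (d n : nat) (X : 'I_n -> Omega -> 'rV[R]_d) (i : nat) :
    set (set Omega) :=
  <<s [set A | exists k : 'I_n, (k < i)%N /\
         exists2 B, <<s @open 'rV[R]_d >> B & A = X k @^-1` B] >>.

Definition Theta E (d : nat) (X : Omega -> 'rV[R]_d) : set 'rV[R]_d :=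
  [set theta | forall p, dotp theta p <= E (fun w => dotp p (X w))].

End independence.

Section conditional_expectation.
Context d (T : measurableType d) (R : realType).

Definition mean_rV (P : probability T R) (m : nat) (X : T -> 'rV[R]_m) :
    'rV[R]_m :=
  \row_j fine ('E_P[fun w => X w ord0 j])%E.

(* Y is a version of E_P[X | G], where G is a sub-sigma-algebra. *)
Definition is_cond_expectation (P : probability T R) (G : set (set T))
    (X Y : T -> R) :=
  [/\ forall B : set R, measurable B -> G (Y @^-1` B),
      P.-integrable [set: T] (EFin \o Y) &
      forall A, G A ->
        (\int[P]_(w in A) (Y w)%:E = \int[P]_(w in A) (X w)%:E)%E].

Definition is_cond_expectation_rV (P : probability T R) (G : set (set T))
    (m : nat) (X Y : T -> 'rV[R]_m) :=
  forall j, is_cond_expectation P G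
    (fun w => X w ord0 j) (fun w => Y w ord0 j).

End conditional_expectation.

(* Main.v *)
Require Import Defs.
From HB Require Import structures.
From mathcomp Require Import all_boot all_order all_algebra.
From mathcomp Require Import all_classical all_reals all_analysis.
From mathcomp Require Import measurable_realfun ring lra.

Set Implicit Arguments.
Unset Strict Implicit.
Unset Printing Implicit Defensive.

Import Order.TTheory GRing.Theory Num.Theory.
Import numFieldTopology.Exports numFieldNormedType.Exports.

Local Open Scope classical_set_scope.
Local Open Scope ring_scope.

(** The idea. On L^1 the extended functional is still the upper expectation:
    [E Z] is the least upper bound of the means of [Z] over the representing set
    ([mean_le_E], [E_le_of_means]). Everything else is deduced from these two
    inequalities, and a Lipschitz function of a vector with coordinates in L^1
    stays in L^1 ([Lp1_l1_lipschitz_comp]), so they apply to every expectation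
    that occurs.

    First claim. Each mean of [X_i] lies in [Theta] because the mean of
    [<p, X_i>] is at most [E <p, X_i>]. Conversely the means form a convex set,
    and [P |-> E_P X_i] is continuous on the weakly compact representing set as a
    uniform limit of means of bounded continuous functions. So a point of
    [Theta] has a nearest mean; the variational inequality at that mean is the
    separation that forces the distance to be zero ([Theta_mean]).

    Second claim. Let [Z] be the past of [X_i], [phi >= 0] and [psi] bounded
    Lipschitz, and [c = E (psi X_i)]. Freezing the past, independence gives
    [E (phi Z * (psi X_i - c)) = 0], hence the mean of [phi Z * (psi X_i - c)]
    is nonpositive under every representing [P] ([independence_mean_le0]).
    The indicator of an event of the past sigma-algebra is an L^1(P)-limit of
    functions [phi Z] with values in [0, 1] ([past_approximable]), so [phi Z] may be
    replaced by an indicator [1_A]; truncating [<p, x>] then gives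
    [E_P (1_A * <p, X_i>) <= P A * E <p, X_i>] ([event_mean_dotp_le]). Taking for
    [A] the event where the conditional mean of [<p, X_i>] exceeds
    [E <p, X_i>] shows that this event is null. Countably many directions [p]
    suffice, since both sides are continuous in [p] ([Theta_of_rational]). *)

(** * Integrals under a probability measure *)

Section probability_integral.
Context d (T : measurableType d) (R : realType) (P : probability T R).
Implicit Types f g : T -> R.

Lemma bounded_integrable (M : R) f : measurable_fun [set: T] f ->
  (forall w, `|f w| <= M) -> P.-integrable [set: T] (EFin \o f).
Proof.
move=> mf fM; apply: measurable_bounded_integrable => //.
  by rewrite ltey_eq fin_num_measure.
exists M; split; first exact: num_real.
by move=> x Mx w _ /=; rewrite (le_trans (fM w))// ltW.
Qed.

Lemma integrable_add f g : P.-integrable [set: T] (EFin \o f) ->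
  P.-integrable [set: T] (EFin \o g) ->
  P.-integrable [set: T] (EFin \o (fun w => f w + g w)).
Proof. by move=> fi gi; exact: (integrableD measurableT fi gi). Qed.

Lemma integrable_sub f g : P.-integrable [set: T] (EFin \o f) ->
  P.-integrable [set: T] (EFin \o g) ->
  P.-integrable [set: T] (EFin \o (fun w => f w - g w)).
Proof. by move=> fi gi; exact: (integrableB measurableT fi gi). Qed.

Lemma integrable_scale (c : R) f : P.-integrable [set: T] (EFin \o f) ->
  P.-integrable [set: T] (EFin \o (fun w => c * f w)).
Proof. by move=> fi; exact: (integrableZl measurableT c fi). Qed.

Lemma Rintegral_cst_prob (c : R) : \int[P]_w c = c.
Proof. by rewrite Rintegral_cst//= probability_setT mulr1. Qed.

Lemma fine_expectation f : fine ('E_P[f])%E = \int[P]_w f w.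
Proof. by rewrite unlock. Qed.

Lemma expectation_Rintegral f : P.-integrable [set: T] (EFin \o f) ->
  ('E_P[f])%E = (\int[P]_w f w)%:E.
Proof.
by move=> fi; rewrite unlock /Rintegral fineK//; exact: integrable_fin_num.
Qed.

Lemma integrable_of_abs_le (e : R) f : measurable_fun [set: T] f ->
  (\int[P]_w `|f w|%:E <= e%:E)%E ->
  P.-integrable [set: T] (EFin \o f) /\ \int[P]_w `|f w| <= e.
Proof.
move=> mf fe.
have fi : P.-integrable [set: T] (EFin \o f).
  apply/integrableP; split; first exact/measurable_EFinP.
  exact: le_lt_trans (ltry e).
split=> //; rewrite -lee_fin /Rintegral fineK//.
by apply: integrable_fin_num => //; exact: integrable_norm.
Qed.

Lemma abs_Rintegral_le (e : R) f : P.-integrable [set: T] (EFin \o f) ->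
  \int[P]_w `|f w| <= e -> `|\int[P]_w f w| <= e.
Proof. by move=> fi; apply: le_trans; exact: le_normr_Rintegral. Qed.

Lemma Rintegral_close (e : R) f g : P.-integrable [set: T] (EFin \o f) ->
  P.-integrable [set: T] (EFin \o g) -> \int[P]_w `|f w - g w| <= e ->
  `|\int[P]_w f w - \int[P]_w g w| <= e.
Proof.
move=> fi gi; rewrite -RintegralB// => fg; apply: abs_Rintegral_le => //.
exact: integrable_sub.
Qed.

Lemma Rintegral_sum (I : Type) (r : seq I) (F : I -> T -> R) :
  (forall i, P.-integrable [set: T] (EFin \o F i)) ->
  P.-integrable [set: T] (EFin \o (fun w => \sum_(i <- r) F i w)) /\
  \int[P]_w (\sum_(i <- r) F i w) = \sum_(i <- r) \int[P]_w F i w.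
Proof.
move=> Fi; elim: r => [|i r [IHi IH]].
  under [X in Rintegral _ _ X]eq_fun do rewrite big_nil.
  rewrite big_nil Rintegral_cst_prob; split=> //.
  rewrite (_ : _ \o _ = cst 0%E); first exact: integrable0.
  by apply/funext => w /=; rewrite big_nil.
have eqF : (fun w => \sum_(j <- i :: r) F j w) =
           (fun w => F i w + \sum_(j <- r) F j w).
  by apply/funext => w; rewrite big_cons.
rewrite eqF big_cons RintegralD// IH; split=> //.
exact: integrable_add.
Qed.

Lemma indic_integrable (A : set T) : measurable A ->
  P.-integrable [set: T] (EFin \o (\1_A : T -> R)).
Proof.
move=> mA; apply: (bounded_integrable (M := 1)); first exact: measurable_indic.
by move=> w; rewrite indicE ger0_norm ?ler0n// lern1 leq_b1.
Qed.

Lemma Rintegral_indic (A : set T) : measurable A ->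
  (\int[P]_w \1_A w)%R = fine (P A).
Proof. by move=> mA; rewrite /Rintegral integral_indic// setIT. Qed.

Lemma Rintegral_indic_mul (A : set T) (f : T -> R) :
  \int[P]_(w in A) f w = \int[P]_w (\1_A w * f w).
Proof.
rewrite Rintegral_mkcond; apply: eq_Rintegral => w _.
by rewrite patchE indicE; case: (w \in A); rewrite ?mul1r ?mul0r.
Qed.

Lemma integrable_indic_mul (A : set T) f : measurable A ->
  P.-integrable [set: T] (EFin \o f) ->
  P.-integrable [set: T] (EFin \o (fun w => \1_A w * f w)).
Proof.
move=> mA fi; apply: le_integrable (fi) => //.
  apply/measurable_EFinP; apply: measurable_funM; first exact: measurable_indic.
  by apply/measurable_EFinP; exact: measurable_int fi.
move=> w _; rewrite /= lee_fin normrM indicE.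
by case: (w \in A); rewrite ?normr1 ?mul1r// normr0 mul0r.
Qed.

End probability_integral.

Lemma measurable_fun_open d (T : measurableType d) (R : realType) (f : T -> R) :
  (forall U : set R, open U -> measurable (f @^-1` U)) ->
  measurable_fun [set: T] f.
Proof.
move=> fU; apply: (measurability _ (RGenOpens.measurableE R)).
move=> _ [_ [a [b ->]] <-]; rewrite setTI.
exact/fU/interval_open.
Qed.

Section mixture.
Context d (T : measurableType d) (R : realType).
Variables (P Q S : probability T R) (t : R).
Hypothesis t01 : 0 <= t <= 1.
Hypothesis SPQ : forall A, measurable A ->
  S A = (t%:E * P A + (1 - t)%:E * Q A)%E.

Lemma ge0_Rintegral_mixture (f : T -> R) : (forall w, 0 <= f w) ->
  P.-integrable [set: T] (EFin \o f) -> Q.-integrable [set: T] (EFin \o f) ->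
  \int[S]_w f w = t * \int[P]_w f w + (1 - t) * \int[Q]_w f w.
Proof.
move=> f0 fP fQ; have /andP[t0 t1] := t01.
have s0 : 0 <= 1 - t by rewrite subr_ge0.
have mf : measurable_fun [set: T] (EFin \o f) by exact: measurable_int fP.
have f0' w : [set: T] w -> (0 <= (f w)%:E)%E by rewrite lee_fin.
rewrite /Rintegral (eq_measure_integral
  (measure_add (mscale (NngNum t0) P) (mscale (NngNum s0) Q))); last first.
  move=> A mA _.
  rewrite -[LHS]/(S A) SPQ//.
  exact: esym (measure_addE (mscale (NngNum t0) P) (mscale (NngNum s0) Q) A).
rewrite ge0_integral_measure_add// !ge0_integral_mscale//=.
have fPn := integrable_fin_num measurableT fP.
have fQn := integrable_fin_num measurableT fQ.
by rewrite fineD ?fin_numM// !fineM.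
Qed.

(** Reduced to the nonnegative case by [f = |f| - (|f| - f)]. *)
Lemma Rintegral_mixture (f : T -> R) :
  P.-integrable [set: T] (EFin \o f) -> Q.-integrable [set: T] (EFin \o f) ->
  S.-integrable [set: T] (EFin \o f) ->
  \int[S]_w f w = t * \int[P]_w f w + (1 - t) * \int[Q]_w f w.
Proof.
move=> fP fQ fS.
have afP : P.-integrable setT (EFin \o (fun w => `|f w|)) := integrable_norm fP.
have afQ : Q.-integrable setT (EFin \o (fun w => `|f w|)) := integrable_norm fQ.
have afS : S.-integrable setT (EFin \o (fun w => `|f w|)) := integrable_norm fS.
have sf0 w : 0 <= `|f w| - f w by rewrite subr_ge0 ler_norm.
have := ge0_Rintegral_mixture sf0 (integrable_sub afP fP) (integrable_sub afQ fQ).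
have := ge0_Rintegral_mixture (fun w => normr_ge0 (f w)) afP afQ.
by rewrite !RintegralB// => ->; lra.
Qed.

End mixture.

(** * The space L^1 of a sublinear expectation *)

Section quasi_sure_L1.
Context (R : realType) (Omega : completeMetricType R).
Implicit Types (PP : set (probability (borel Omega) R)) (f u X : Omega -> R).

(** A bound on the L^1 norm with respect to the upper expectation, in terms of
    real integrals only; integrability is included because [fine] turns an infinite
    integral into [0]. *)
Definition uniform_L1_le PP (e : R) f := forall P : probability (borel Omega) R,
  PP P -> P.-integrable [set: borel Omega] (EFin \o f) /\
          \int[P]_w `|f w| <= e.

Lemma CbLip_continuous u : CbLip Omega u -> continuous (u : Omega -> R).
Proof.
move=> [_ [k uk]] x.
apply/cvgrPdist_lt => e e0; near=> y.
have k0 : 0 < `|k| + 1 by rewrite ltr_wpDl.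
have xy : mdist x y < e / (`|k| + 1).
  near: y; apply/nbhs_ballP; exists (e / (`|k| + 1)); first exact: divr_gt0.
  by move=> y; rewrite ballEmdist.
rewrite (le_lt_trans (uk x y))// (le_lt_trans (_ : _ <= (`|k| + 1) * mdist x y))//.
  rewrite ler_wpM2r// ?mdist_ge0//.
  by rewrite (le_trans (ler_norm _))// lerDl.
by rewrite mulrC -ltr_pdivlMr.
Unshelve. all: by end_near. Qed.

Lemma continuous_borel_measurable u : continuous (u : Omega -> R) ->
  measurable_fun [set: borel Omega] u.
Proof.
move=> /continuousP uc; apply: measurable_fun_open => U /uc oU.
exact: sub_sigma_algebra.
Qed.

Lemma CbLip_measurable u : CbLip Omega u -> measurable_fun [set: borel Omega] u.
Proof. by move=> /CbLip_continuous; exact: continuous_borel_measurable. Qed.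

Lemma CbLip_integrable (P : probability (borel Omega) R) u :
  CbLip Omega u -> P.-integrable [set: borel Omega] (EFin \o u).
Proof.
move=> ubl; have [[M uM] _] := ubl.
exact: (@bounded_integrable _ (borel Omega) _ P M u (CbLip_measurable ubl) uM).
Qed.

(** Raises the norm bound to the power [p], one probability at a time. *)
Lemma Lp_norm_le PP (p : R) f (e : R) : 0 < p -> 0 <= e ->
  (Lp_norm PP p f <= e%:E)%E ->
  forall P, PP P -> ('E_P[fun w => (`|f w| `^ p)%R] <= (e `^ p)%:E)%E.
Proof.
move=> p0 e0; rewrite /Lp_norm => fe P PPP.
set s := upper_expectation PP _ in fe.
have Ps : ('E_P[fun w => (`|f w| `^ p)%R] <= s)%E.
  by apply: ereal_sup_ubound; exists P.
apply: (le_trans Ps).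
have s0 : (0 <= s)%E.
  by apply: le_trans Ps; apply: expectation_ge0 => w; exact: powR_ge0.
have -> : s = ((s `^ p^-1) `^ p)%E.
  by rewrite -poweRrM mulVf ?gt_eqF// poweRe1.
rewrite -poweR_EFin; apply: gt0_ler_poweR => //; first exact: ltW.
- by rewrite in_itv/= poweR_ge0 leey.
- by rewrite in_itv/= lee_fin e0 leey.
Qed.

End quasi_sure_L1.

Section L1_membership.
Context (R : realType) (Omega : completeMetricType R).
Variable PP : set (probability (borel Omega) R).
Implicit Types (f u X : Omega -> R).

Lemma Lp_norm1_uniform f e : measurable_fun [set: borel Omega] f -> 0 <= e ->
  (Lp_norm PP 1 f <= e%:E)%E -> uniform_L1_le PP e f.
Proof.
move=> mf e0 /(Lp_norm_le ltr01 e0) fe P /fe.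
rewrite unlock powRr1// => fP; apply: integrable_of_abs_le => //.
by under eq_integral do rewrite -[`|_|]powRr1//.
Qed.

(** [|x| <= (e + x^2 / e) / 2] trades the quadratic norm for the linear one. *)
Lemma Lp_norm2_uniform f e : measurable_fun [set: borel Omega] f -> 0 < e ->
  (Lp_norm PP 2 f <= e%:E)%E -> uniform_L1_le PP e f.
Proof.
move=> mf e0 /(Lp_norm_le (ltr0n _ 2) (ltW e0)) fe P /fe.
rewrite unlock powR_mulrn ?(ltW e0)// => fP; apply: integrable_of_abs_le => //.
pose g w := f w ^+ 2.
have mg : measurable_fun [set: borel Omega] g by exact: measurable_funX.
have gE w : `|f w| `^ 2 = g w.
  by rewrite powR_mulrn// real_normK// num_real.
have g0 w : 0 <= g w by exact: sqr_ge0.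
have [gi ig] : P.-integrable [set: borel Omega] (EFin \o g) /\
    \int[P]_w `|g w| <= e ^+ 2.
  apply: integrable_of_abs_le => //.
  by under eq_integral do rewrite ger0_norm// -gE.
have {}ig : \int[P]_w g w <= e ^+ 2.
  by under eq_Rintegral do rewrite -[g _]ger0_norm//.
pose h w := 2^-1 * (e + e^-1 * g w).
have hi : P.-integrable [set: borel Omega] (EFin \o h).
  apply: integrable_scale; apply: integrable_add.
    exact: (@bounded_integrable _ _ _ P `|e| (cst e)).
  exact: integrable_scale.
apply: (@le_trans _ _ (\int[P]_w (h w)%:E)%E).
  apply: ge0_le_integral => //.
  - by apply/measurable_EFinP; exact: measurableT_comp.
  - exact: measurable_int hi.
  move=> w _; rewrite lee_fin /h /g -[f w ^+ 2]real_normK ?num_real//.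
  set y := `|f w|; rewrite -subr_ge0.
  have -> : 2^-1 * (e + e^-1 * y ^+ 2) - y = 2^-1 * e^-1 * (e - y) ^+ 2.
    by field; rewrite gt_eqF.
  by rewrite mulr_ge0 ?sqr_ge0// mulr_ge0 ?invr_ge0 ?(ltW e0).
rewrite -[X in (X <= _)%E]fineK ?integrable_fin_num//.
rewrite lee_fin -[fine _]/(\int[P]_w (h w)).
rewrite RintegralZl//; last first.
  apply: integrable_add; last exact: integrable_scale.
  exact: (@bounded_integrable _ _ _ P `|e| (cst e)).
rewrite RintegralD//; last 2 first.
- exact: (@bounded_integrable _ _ _ P `|e| (cst e)).
- exact: integrable_scale.
rewrite RintegralZl// Rintegral_cst_prob.
have : e^-1 * \int[P]_w g w <= e.
  by rewrite mulrC ler_pdivrMr// -expr2.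
by lra.
Qed.

Lemma uniform_Lp_norm1 f e : 0 <= e -> PP !=set0 -> uniform_L1_le PP e f ->
  (Lp_norm PP 1 f <= e%:E)%E.
Proof.
move=> e0 [Q PPQ] fe.
rewrite /Lp_norm; set s := upper_expectation _ _.
have s0 : (0 <= s)%E.
  apply: (@le_trans _ _ ('E_Q[fun w => (`|f w| `^ 1)%R])%E).
    by apply: expectation_ge0 => w; exact: powR_ge0.
  by apply: ereal_sup_ubound; exists Q.
rewrite invr1 poweRe1//; apply: ge_ereal_sup => _ [P PPP <-].
have [fi fle] := fe P PPP.
have -> : (fun w => `|f w| `^ 1) = (fun w => `|f w|).
  by apply/funext => w; rewrite powRr1.
rewrite (@expectation_Rintegral _ _ _ P) ?lee_fin//.
exact: (integrable_norm fi).
Qed.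

(** Membership in L^1 without extended norms: approximability by bounded
    Lipschitz functions in mean, uniformly over the probabilities. *)
Definition approximable X := forall e, 0 < e ->
  exists2 u, CbLip Omega u & uniform_L1_le PP e (fun w => u w - X w).

Lemma Lp_approx_uniform p X (u : nat -> Omega -> R) : (forall f e,
    measurable_fun [set: borel Omega] f -> 0 < e ->
    (Lp_norm PP p f <= e%:E)%E -> uniform_L1_le PP e f) ->
  measurable_fun [set: borel Omega] X -> Lp_approx PP p X u ->
  forall e, 0 < e ->
  \forall k \near \oo, uniform_L1_le PP e (fun w => u k w - X w).
Proof.
move=> pP mX [uL uX] e e0.
have : \forall k \near \oo, (Lp_norm PP p (fun w => (u k w - X w)%R) < e%:E)%E.
  apply: (uX [set x : \bar R | (x < e%:E)%E]).
  by apply: open_ereal_lt'; rewrite lte_fin.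
apply: filterS => k /ltW; apply: pP => //.
by apply: measurable_funB => //; exact: CbLip_measurable.
Qed.

Lemma Lp1_near X (u : nat -> Omega -> R) : measurable_fun [set: borel Omega] X ->
  Lp_approx PP 1 X u -> forall e, 0 < e ->
  \forall k \near \oo, uniform_L1_le PP e (fun w => u k w - X w).
Proof.
apply: Lp_approx_uniform => f e mf e0; exact: Lp_norm1_uniform (ltW e0).
Qed.

Lemma Lp1_approximable X : Lp PP 1 X -> approximable X.
Proof.
move=> [mX [u uX]] e e0; have [k uk] := filter_ex (Lp1_near mX uX e0).
by exists (u k) => //; exact: uX.1.
Qed.

Lemma approximable_Lp1 X : PP !=set0 ->
  measurable_fun [set: borel Omega] X -> approximable X -> Lp PP 1 X.
Proof.
move=> PP0 mX aX; split=> //.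
have Hu k : exists u, CbLip Omega u /\
    uniform_L1_le PP k.+1%:R^-1 (fun w => u w - X w).
  by have [|u] := aX k.+1%:R^-1; [rewrite invr_gt0|exists u].
have [u uP] := choice Hu; exists u; split=> [k|]; first exact: (uP k).1.
have norm0 k : (0 <= Lp_norm PP 1 (fun w => (u k w - X w)%R))%E.
  exact: poweR_ge0.
apply: (@squeeze_cvge _ _ _ _ (cst 0%E) _ (fun k => (k.+1%:R^-1)%:E)).
- apply: nearW => k; rewrite norm0/=.
  by apply: uniform_Lp_norm1 => //; exact: (uP k).2.
- exact: cvg_cst.
- exact: cvge_harmonic.
Qed.

Lemma Lp2_Lp1 X : PP !=set0 -> Lp PP 2 X -> Lp PP 1 X.
Proof.
move=> PP0 [mX [u uX]]; apply: approximable_Lp1 => // e e0.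
have [k uk] := filter_ex (Lp_approx_uniform Lp_norm2_uniform mX uX e0).
by exists (u k) => //; exact: uX.1.
Qed.

Lemma Lp1_integrable X (P : probability (borel Omega) R) :
  Lp PP 1 X -> PP P -> P.-integrable [set: borel Omega] (EFin \o X).
Proof.
move=> /Lp1_approximable /(_ _ ltr01)[u uL uX] /uX[uXi _].
have -> : EFin \o X = EFin \o (fun w => u w - (u w - X w)).
  by apply/funext => w /=; rewrite opprB addrC subrK.
by apply: integrable_sub => //; exact: CbLip_integrable.
Qed.

End L1_membership.

(** * The extended expectation is the upper expectation on L^1 *)

Section upper_representation.
Context (R : realType) (Omega : completeMetricType R).
Variables (E : (Omega -> R) -> R) (PP : set (probability (borel Omega) R)).
Hypothesis E_repr : forall X, CbLip Omega X -> (E X)%:E = upper_expectation PP X.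
Hypothesis E_ext : L1_extended PP E.
Implicit Types (X : Omega -> R) (P : probability (borel Omega) R).

Lemma CbLip_cst (c : R) : CbLip Omega (cst c).
Proof.
split; first by exists `|c|.
by exists 0 => x y; rewrite subrr normr0 mul0r.
Qed.

(** The upper expectation over the empty set would be [-oo], yet [E 0] is real. *)
Lemma representing_set_neq0 : PP !=set0.
Proof.
apply/set0P/eqP => PP0; have := E_repr (CbLip_cst 0).
by rewrite /upper_expectation PP0 image_set0 ereal_sup0.
Qed.

Let Lp1_CbLip X e : Lp PP 1 X -> 0 < e ->
  exists u, [/\ CbLip Omega u, uniform_L1_le PP e (fun w => u w - X w) &
                `|E u - E X| <= e].
Proof.
move=> X1 e0; have [mX [u uX]] := X1.
have near1 := Lp1_near mX uX e0.
have near2 : \forall k \near \oo, `|E (u k) - E X| <= e.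
  have /cvgrPdist_le/(_ e e0) := E_ext X1 uX.
  by apply: filterS => k; rewrite distrC.
have [k [uk1 uk2]] := filter_ex (filterI near1 near2).
by exists (u k); split=> //; exact: uX.1.
Qed.

(** With [E_le_of_means] this says that [E X] is the supremum of the means for
    all [X] in L^1: both sides move by at most [e] when [X] is replaced by a
    bounded Lipschitz approximation, uniformly over the probabilities. *)
Lemma mean_le_E X P : Lp PP 1 X -> PP P -> \int[P]_w X w <= E X.
Proof.
move=> X1 PPP; apply/ler_addgt0Pr => e e0.
have e20 : 0 < e / 2 by rewrite divr_gt0.
have [u [uL uX Eu]] := Lp1_CbLip X1 e20.
have [_ uXP] := uX P PPP.
have := Rintegral_close (CbLip_integrable P uL) (Lp1_integrable X1 PPP) uXP.
have : \int[P]_w u w <= E u.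
  rewrite -lee_fin E_repr// -(@expectation_Rintegral _ _ _ P).
    by apply: ereal_sup_ubound; exists P.
  exact: CbLip_integrable.
by move: Eu; rewrite !ler_norml => /andP[? ?] ? /andP[? ?]; lra.
Qed.

Lemma E_le_of_means X b : Lp PP 1 X ->
  (forall P, PP P -> \int[P]_w X w <= b) -> E X <= b.
Proof.
move=> X1 Xb; apply/ler_addgt0Pr => e e0.
have e20 : 0 < e / 2 by rewrite divr_gt0.
have [u [uL uX Eu]] := Lp1_CbLip X1 e20.
have : E u <= b + e / 2.
  rewrite -lee_fin E_repr//; apply: ge_ereal_sup => _ [P PPP <-].
  have [_ uXP] := uX P PPP.
  have := Rintegral_close (CbLip_integrable P uL) (Lp1_integrable X1 PPP) uXP.
  rewrite (@expectation_Rintegral _ _ _ P) ?lee_fin; last exact: CbLip_integrable.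
  by have := Xb P PPP; rewrite ler_norml => ? /andP[? ?]; lra.
by move: Eu; rewrite !ler_norml => /andP[? ?] ?; lra.
Qed.

End upper_representation.

(** * Lipschitz functions of random vectors *)

Section l1_geometry.
Context (R : realType).

Lemma ord_sum_le m (F : 'I_m -> R) e :
  (forall j, F j <= e) -> \sum_j F j <= m%:R * e.
Proof.
move=> Fe; apply: (@le_trans _ _ (\sum_(j < m) e)); first exact: ler_sum.
by rewrite sumr_const card_ord mulr_natl.
Qed.

(** The sum distance is equivalent to the Euclidean one but additive over
    coordinates and blocks, as are the integrals of coordinate errors. *)
Definition l1dist m (x y : 'rV[R]_m) : R := \sum_(j < m) `|x ord0 j - y ord0 j|.

Definition l1_lipschitz m (k : R) (psi : 'rV[R]_m -> R) :=
  forall x y, `|psi x - psi y| <= k * l1dist x y.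

Lemma l1dist_ge0 m (x y : 'rV[R]_m) : 0 <= l1dist x y.
Proof. by apply: sumr_ge0 => j _. Qed.

Lemma l1distxx m (x : 'rV[R]_m) : l1dist x x = 0.
Proof. by rewrite /l1dist big1// => j _; rewrite subrr normr0. Qed.

Lemma l1dist_triangle m (x y z : 'rV[R]_m) :
  l1dist x z <= l1dist x y + l1dist y z.
Proof. by rewrite -big_split/= ler_sum// => j _; exact: ler_distD. Qed.

Lemma l1distC m (x y : 'rV[R]_m) : l1dist x y = l1dist y x.
Proof. by apply: eq_bigr => j _; rewrite distrC. Qed.

Lemma coord_le_l1dist m (x y : 'rV[R]_m) j :
  `|x ord0 j - y ord0 j| <= l1dist x y.
Proof. by rewrite /l1dist (bigD1 j)//= lerDl sumr_ge0. Qed.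

Lemma l1dist_row_mx m1 m2 (x x' : 'rV[R]_m1) (y y' : 'rV[R]_m2) :
  l1dist (row_mx x y) (row_mx x' y') = l1dist x x' + l1dist y y'.
Proof.
rewrite /l1dist big_split_ord/=.
by congr (_ + _); apply: eq_bigr => j _; rewrite ?row_mxEl ?row_mxEr.
Qed.

Lemma euclidean_le_l1 m (x y : 'rV[R]_m) : euclidean_dist x y <= l1dist x y.
Proof.
rewrite /euclidean_dist -[leRHS]ger0_norm ?l1dist_ge0// -sqrtr_sqr ler_wsqrtr//.
rewrite expr2 [X in X * _]/l1dist mulr_suml; apply: ler_sum => j _.
rewrite !mxE -expr2 -real_normK ?num_real// expr2 ler_wpM2l//.
exact: coord_le_l1dist.
Qed.

Lemma l1_le_euclidean m (x y : 'rV[R]_m) :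
  l1dist x y <= m%:R * euclidean_dist x y.
Proof.
apply: ord_sum_le => j; rewrite /euclidean_dist -sqrtr_sqr ler_wsqrtr//.
rewrite /dotp (bigD1 j)//= !mxE -expr2.
by rewrite lerDl sumr_ge0// => i _; rewrite -expr2 sqr_ge0.
Qed.

Lemma CbLip_rVP m (psi : 'rV[R]_m -> R) : CbLip_rV psi <->
  (exists M, forall x, `|psi x| <= M) /\ (exists2 k, 0 <= k & l1_lipschitz k psi).
Proof.
split=> -[b [k]]; last first.
  move=> k0 lip; split=> //; exists (k * m%:R) => x y.
  by rewrite (le_trans (lip x y))// -mulrA ler_wpM2l// l1_le_euclidean.
move=> lip; split=> //; exists `|k| => // x y.
have e0 : 0 <= euclidean_dist x y by exact: sqrtr_ge0.
rewrite (le_trans (lip x y))// (le_trans (_ : _ <= `|k| * euclidean_dist x y))//.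
  by rewrite ler_wpM2r// ler_norm.
by rewrite ler_wpM2l// euclidean_le_l1.
Qed.

Lemma nbhs_rVP m (x : 'rV[R]_m) (A : set 'rV[R]_m) : nbhs x A <->
  exists2 e : R, 0 < e &
    forall y : 'rV[R]_m, (forall j, `|x ord0 j - y ord0 j| < e) -> A y.
Proof.
split=> [/nbhs_ballP[e /= e0 xeA]|[e e0 xeA]].
  exists e => // y xy; apply: xeA; split=> // i j.
  by rewrite ord1; exact: xy.
apply/nbhs_ballP; exists e => //= y [_ xy].
by apply: xeA => j; exact: xy.
Qed.

Lemma open_l1_lipschitz_preimage m k (psi : 'rV[R]_m -> R) (U : set R) :
  l1_lipschitz k psi -> open U -> open (psi @^-1` U).
Proof.
move=> lip oU; rewrite openE => x Ux.
have /nbhs_ballP[e /= e0 xeU] := open_nbhs_nbhs (conj oU Ux).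
have D0 : 0 < (`|k| + 1) * m.+1%:R by rewrite mulr_gt0// ltr_wpDl.
apply/nbhs_rVP; exists (e / ((`|k| + 1) * m.+1%:R)); first exact: divr_gt0.
move=> y xy; apply: xeU => /=; rewrite -ball_normE /=.
have l1e : (`|k| + 1) * l1dist x y <= e * (m%:R / m.+1%:R).
  rewrite -ler_pdivlMl ?ltr_wpDl//.
  have -> : (`|k| + 1)^-1 * (e * (m%:R / m.+1%:R)) =
      m%:R * (e / ((`|k| + 1) * m.+1%:R)).
    by rewrite invfM; ring.
  by apply: ord_sum_le => j; exact/ltW/xy.
rewrite (le_lt_trans (lip x y))// (le_lt_trans (_ : _ <= (`|k| + 1) * l1dist x y))//.
  by rewrite ler_wpM2r ?l1dist_ge0// (le_trans (ler_norm _))// lerDl.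
by rewrite (le_lt_trans l1e)// gtr_pMr// ltr_pdivrMr// mul1r ltr_nat.
Qed.

End l1_geometry.

Section random_vector_measurability.
Context d (T : measurableType d) (R : realType) (m : nat).
Variable X : T -> 'rV[R]_m.
Hypothesis mX : forall j, measurable_fun [set: T] (fun w => X w ord0 j).

(** An open set is the countable union of the rational boxes that it contains,
    and preimages of boxes only involve the coordinates of [X]. *)
Lemma measurable_preimage_open (U : set 'rV[R]_m) :
  open U -> measurable (X @^-1` U).
Proof.
move=> oU.
pose box (b : 'rV[rat]_m * rat) : set 'rV[R]_m :=
  [set x | forall j, `|ratr (b.1 ord0 j) - x ord0 j| < ratr b.2].
pose F b := X @^-1` (if `[< box b `<=` U >] then box b else set0).
have -> : X @^-1` U = \bigcup_b F b.
  apply/seteqP; split=> [w Uw|w [b _]]; last first.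
    by rewrite /F; case: asboolP => // bU; exact: bU.
  have /nbhs_rVP[e e0 eU] := open_nbhs_nbhs (conj oU Uw).
  have [r] : exists r : rat, ratr r \in `]0, (e / 2)[.
    by apply: rat_in_itvoo; rewrite divr_gt0.
  rewrite in_itv/= => /andP[r0 re].
  have Hq j : exists q : rat, `|ratr q - X w ord0 j| < ratr r.
    have [q] : exists q : rat,
        ratr q \in `](X w ord0 j - ratr r), (X w ord0 j + ratr r)[.
      by apply: rat_in_itvoo; rewrite ltrD2l gtrN.
    rewrite in_itv/= => /andP[q1 q2].
    by exists q; rewrite ltr_norml; apply/andP; split; lra.
  have [q qP] := choice Hq.
  have bw : box (\row_j q j, r) (X w) by move=> j /=; rewrite mxE.
  suff bU : box (\row_j q j, r) `<=` U.
    by exists (\row_j q j, r) => //; rewrite /F asboolT.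
  move=> y yb; apply: eU => j.
  have := bw j; have := yb j; rewrite /= mxE => yj wj.
  rewrite (le_lt_trans (ler_distD (ratr (q j)) _ _))//.
  by rewrite distrC; lra.
apply: countable_bigcupT_measurable; first exact: countableP.
move=> b; rewrite /F; case: ifP => _; last by rewrite preimage_set0.
have -> : X @^-1` box b = \bigcap_(j in [set: 'I_m])
    ((fun w => `|ratr (b.1 ord0 j) - X w ord0 j|) @^-1` [set x | x < ratr b.2]).
  by apply/seteqP; split=> [w h j _|w h j]; [exact: h j|exact: h j I].
rewrite -[X in measurable X]setCK setC_bigcap; apply: measurableC.
apply: countable_bigcupT_measurable; first exact: countableP.
move=> j; apply: measurableC; rewrite -[X in measurable X]setTI.
have mf : measurable_fun [set: T] (fun w => `|ratr (b.1 ord0 j) - X w ord0 j| : R).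
  by apply: measurableT_comp => //; exact: measurable_funB.
apply: mf => //.
by rewrite (_ : [set x | _] = `]-oo, ratr b.2[%classic).
Qed.

Lemma measurable_l1_lipschitz_comp k psi : l1_lipschitz k psi ->
  measurable_fun [set: T] (fun w => psi (X w)).
Proof.
move=> lip; apply: measurable_fun_open => U oU.
exact: (measurable_preimage_open (open_l1_lipschitz_preimage lip oU)).
Qed.

End random_vector_measurability.

(** A Lipschitz function of a vector with coordinates in L^1 is in L^1: apply
    it to the bounded Lipschitz approximations of the coordinates. *)
Section Lipschitz_of_L1.
Context (R : realType) (Omega : completeMetricType R).
Variable PP : set (probability (borel Omega) R).
Hypothesis PP0 : PP !=set0.

Lemma CbLip_l1_lipschitz_comp m k (psi : 'rV[R]_m -> R)
    (u : 'I_m -> Omega -> R) : 0 <= k -> l1_lipschitz k psi ->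
  (forall j, CbLip Omega (u j)) -> CbLip Omega (fun w => psi (\row_j u j w)).
Proof.
move=> k0 lip uL.
have [M uM] := choice (fun j => (uL j).1).
have [c uc] := choice (fun j => (uL j).2).
split.
  exists (`|psi 0| + k * \sum_j M j) => w.
  have -> : psi (\row_j u j w) = psi 0 + (psi (\row_j u j w) - psi 0).
    by rewrite addrC subrK.
  rewrite (le_trans (ler_normD _ _))// lerD2l (le_trans (lip _ _))// ler_wpM2l//.
  by apply: ler_sum => j _; rewrite !mxE subr0.
exists (k * \sum_j c j) => w w'; rewrite (le_trans (lip _ _))// -mulrA ler_wpM2l//.
by rewrite mulr_suml; apply: ler_sum => j _; rewrite !mxE.
Qed.

Lemma Lp1_l1_lipschitz_comp m k (psi : 'rV[R]_m -> R) (X : Omega -> 'rV[R]_m) :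
  0 <= k -> l1_lipschitz k psi -> (forall j, Lp PP 1 (fun w => X w ord0 j)) ->
  Lp PP 1 (fun w => psi (X w)).
Proof.
move=> k0 lip X1.
have mX j : measurable_fun [set: borel Omega] (fun w => X w ord0 j) := (X1 j).1.
have mpsi : measurable_fun [set: borel Omega] (fun w => psi (X w)).
  exact: (@measurable_l1_lipschitz_comp _ (borel Omega) R m X mX k).
apply: approximable_Lp1 => // e e0.
(* A coordinate error [e'] costs at most [k * m * e']; the successors keep the
   quotient meaningful when [k] or [m] is [0]. *)
pose e' := e / ((k + 1) * m.+1%:R).
have D0 : 0 < (k + 1) * m.+1%:R by rewrite mulr_gt0// ltr_wpDl.
have e'0 : 0 < e' by rewrite divr_gt0.
have Hu j : exists u, CbLip Omega u /\
    uniform_L1_le PP e' (fun w => u w - X w ord0 j).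
  by have [u ? ?] := Lp1_approximable (X1 j) e'0; exists u.
have [u uP] := choice Hu.
exists (fun w => psi (\row_j u j w)).
  by apply: CbLip_l1_lipschitz_comp lip _ => // j; exact: (uP j).1.
move=> P PPP.
pose D w := l1dist (\row_j u j w) (X w).
have Dj (j : 'I_m) : P.-integrable [set: borel Omega]
    (EFin \o (fun w => `|u j w - X w ord0 j|)).
  exact: integrable_norm ((uP j).2 P PPP).1.
have [Di DE] := Rintegral_sum (index_enum 'I_m) Dj.
have DD : D = (fun w => \sum_(j <- index_enum 'I_m) `|u j w - X w ord0 j|).
  by apply/funext => w; apply: eq_bigr => j _; rewrite mxE.
rewrite -DD in Di DE.
have dom w : `|psi (\row_j u j w) - psi (X w)| <= k * D w by exact: lip.
have kDi := integrable_scale k Di.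
have mdiff : measurable_fun [set: borel Omega]
    (fun w => psi (\row_j u j w) - psi (X w)).
  apply: measurable_funB => //; apply: CbLip_measurable.
  by apply: CbLip_l1_lipschitz_comp lip _ => // j; exact: (uP j).1.
have psii : P.-integrable [set: borel Omega]
    (EFin \o (fun w => psi (\row_j u j w) - psi (X w))).
  apply: le_integrable kDi => //; first exact/measurable_EFinP.
  move=> w _; rewrite /= lee_fin [leRHS]ger0_norm ?dom//.
  by rewrite mulr_ge0// l1dist_ge0.
split=> //.
apply: (@le_trans _ _ (\int[P]_w (k * D w))).
  by apply: le_Rintegral => //; exact: integrable_norm psii.
rewrite RintegralZl// DE.
apply: (@le_trans _ _ (k * (m%:R * e'))).
  rewrite ler_wpM2l//; apply: ord_sum_le => j; exact: ((uP j).2 P PPP).2.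
rewrite (_ : _ * _ = e * ((k / (k + 1)) * (m%:R / m.+1%:R))); last first.
  by rewrite /e' invfM; ring.
rewrite ler_piMr ?(ltW e0)// mulr_ile1 ?divr_ge0//; first exact: addr_ge0.
  by rewrite ler_pdivrMr ?ltr_wpDl// mul1r lerDl.
by rewrite ler_pdivrMr// mul1r ler_nat.
Qed.

End Lipschitz_of_L1.

(** * The means of a random vector *)

Section dot_product.
Context (R : realType) (m : nat).
Implicit Types p x y z : 'rV[R]_m.

Lemma dotpC x y : dotp x y = dotp y x.
Proof. by apply: eq_bigr => j _; rewrite mulrC. Qed.

Lemma dotpDr p x y : dotp p (x + y) = dotp p x + dotp p y.
Proof. by rewrite -big_split/=; apply: eq_bigr => j _; rewrite mxE mulrDr. Qed.

Lemma dotpZr p c x : dotp p (c *: x) = c * dotp p x.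
Proof. by rewrite mulr_sumr; apply: eq_bigr => j _; rewrite mxE mulrCA. Qed.

Lemma dotpBr p x y : dotp p (x - y) = dotp p x - dotp p y.
Proof. by rewrite dotpDr -scaleN1r dotpZr mulN1r. Qed.

Lemma dotp_subZ x s z : dotp (x - s *: z) (x - s *: z) =
  dotp x x - 2 * s * dotp x z + s ^+ 2 * dotp z z.
Proof.
rewrite dotpBr dotpZr [dotp _ x]dotpC dotpBr dotpZr.
by rewrite [dotp (_ - _) z]dotpC dotpBr dotpZr [dotp z x]dotpC; ring.
Qed.

Lemma dotp_eq0 x : dotp x x <= 0 -> x = 0.
Proof.
move=> x0; apply/rowP => j; rewrite mxE; apply/eqP; rewrite -sqrf_eq0.
rewrite eq_le sqr_ge0 andbT (le_trans _ x0)// /dotp (bigD1 j)//= -expr2.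
by rewrite lerDl sumr_ge0// => i _; rewrite -expr2 sqr_ge0.
Qed.

Lemma dotp_l1_lipschitz p : l1_lipschitz (\sum_j `|p ord0 j|) (dotp p).
Proof.
move=> x y; rewrite -dotpBr (le_trans (ler_norm_sum _ _ _))// mulr_sumr.
apply: ler_sum => j _; rewrite normrM !mxE ler_wpM2r//.
by rewrite (bigD1 j)//= lerDl sumr_ge0.
Qed.

End dot_product.

Section mean_of_dot_product.
Context d (T : measurableType d) (R : realType) (P : probability T R) (m : nat).
Variable X : T -> 'rV[R]_m.
Hypothesis Xi : forall j, P.-integrable [set: T] (EFin \o (fun w => X w ord0 j)).

Lemma mean_rVE j : mean_rV P X ord0 j = \int[P]_w X w ord0 j.
Proof. by rewrite mxE fine_expectation. Qed.

Lemma Rintegral_dotp p : P.-integrable [set: T] (EFin \o (fun w => dotp p (X w)))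
  /\ \int[P]_w dotp p (X w) = dotp p (mean_rV P X).
Proof.
have pXi j := integrable_scale (p ord0 j) (Xi j).
have [? e] := Rintegral_sum (index_enum 'I_m) pXi.
split=> //; rewrite [LHS]e; apply: eq_bigr => j _.
by rewrite RintegralZl// mean_rVE.
Qed.

End mean_of_dot_product.

Section set_of_means.
Context (R : realType) (Omega : completeMetricType R).
Variables (E : (Omega -> R) -> R) (PP : set (probability (borel Omega) R)).
Hypothesis PP_convex : convex_set_of_probabilities PP.
Hypothesis PP_compact : weakly_compact PP.
Hypothesis E_repr : forall X, CbLip Omega X -> (E X)%:E = upper_expectation PP X.
Hypothesis E_ext : L1_extended PP E.

Let W := initial_topology (@weak_eval R Omega).

(** By definition of the weak topology: the mean of [u] is a coordinate of
    [weak_eval]. *)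
Lemma CbLip_mean_continuous u : CbLip Omega u ->
  continuous (fun P : W => \int[P]_w u w).
Proof.
move=> ubl.
pose bu : bounded_continuous Omega := exist _ u (conj (CbLip_continuous ubl) ubl.1).
have -> : (fun P : W => \int[P]_w u w) =
    (fun g : {ptws bounded_continuous Omega -> R} => g bu) \o @weak_eval R Omega.
  by apply/funext => P /=; rewrite /weak_eval -(fine_expectation P u).
have wc : continuous (@weak_eval R Omega : W -> _) by exact: initial_continuous.
move=> P; apply: (@continuous_comp W {ptws bounded_continuous Omega -> R} R
  (@weak_eval R Omega) (fun g => g bu)); first exact: wc.
(* Continuity of projections is stated for index types with decidable equality. *)
exact: (@proj_continuous {classic bounded_continuous Omega}
  (fun=> R : topologicalType) bu).
Qed.

(** Means of bounded Lipschitz functions are continuous in [P], and they converge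
    to the mean of [f] uniformly on the representing set. *)
Lemma Lp1_mean_continuous f : Lp PP 1 f ->
  {within (PP : set W), continuous (fun P : W => \int[P]_w f w)}.
Proof.
move=> f1; apply/subspace_continuousP => P PPP; apply/cvgrPdist_lt => e e0.
have e40 : 0 < e / 4 by rewrite divr_gt0.
have [u uL uf] := Lp1_approximable f1 e40.
have := CbLip_mean_continuous uL (x := P).
move=> /cvgrPdist_lt /(_ _ e40); rewrite near_withinE; apply: filterS => Q uPQ PPQ.
have mean_close S (PPS : PP S) :=
  Rintegral_close (CbLip_integrable S uL) (Lp1_integrable f1 PPS) (uf S PPS).2.
move: uPQ (mean_close P PPP) (mean_close Q PPQ); rewrite /from_subspace /=.
move: (\int[P]_w u w) (\int[Q]_w u w) (\int[P]_w f w) (\int[Q]_w f w) => a b c c'.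
rewrite !ltr_norml !ler_norml => /andP[? ?] /andP[? ?] /andP[? ?].
by apply/andP; split; lra.
Qed.

Variables (m : nat) (X : Omega -> 'rV[R]_m).
Hypothesis X1 : forall j, Lp PP 1 (fun w => X w ord0 j).

Let mean (P : probability (borel Omega) R) : 'rV[R]_m :=
  mean_rV P (X : borel Omega -> 'rV[R]_m).

Lemma Lp1_dotp p : Lp PP 1 (fun w => dotp p (X w)).
Proof.
apply: (Lp1_l1_lipschitz_comp (representing_set_neq0 E_repr) _
  (@dotp_l1_lipschitz R m p) X1).
exact: sumr_ge0.
Qed.

Lemma mean_dotp P p : PP P -> \int[P]_w dotp p (X w) = dotp p (mean P).
Proof.
by move=> PPP; apply: (Rintegral_dotp _ _).2 => j; exact: Lp1_integrable.
Qed.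

Lemma mean_in_Theta P : PP P -> Theta E X (mean P).
Proof.
move=> PPP p; rewrite dotpC -mean_dotp//.
exact: (mean_le_E E_repr E_ext (Lp1_dotp p)).
Qed.

Lemma mean_mixture P Q t : PP P -> PP Q -> 0 <= t <= 1 ->
  exists2 S, PP S & mean S = mean P + (1 - t) *: (mean Q - mean P).
Proof.
move=> PPP PPQ t01; have [S PPS SPQ] := PP_convex PPP PPQ t01; exists S => //.
apply/rowP => j; rewrite !mxE !fine_expectation.
have intg Q' := @Lp1_integrable _ _ PP _ Q' (X1 j).
rewrite (Rintegral_mixture t01 SPQ (intg _ PPP) (intg _ PPQ) (intg _ PPS)).
by ring.
Qed.

Let sqdist (theta : 'rV[R]_m) P := dotp (theta - mean P) (theta - mean P).

(** The squared distance from [theta] is a continuous function of [P] on a compact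
    set, so it attains its minimum. *)
Lemma nearest_mean theta : exists2 P, PP P &
  forall Q, PP Q -> sqdist theta P <= sqdist theta Q.
Proof.
have c : {within (PP : set W), continuous (sqdist theta : W -> R)}.
  apply/subspace_continuousP => P PPP.
  rewrite /sqdist /dotp; apply: cvg_big => [|j _]; first exact: add_continuous.
  have : (theta - mean Q) ord0 j @[Q --> within PP (nbhs (P : W))] -->
         (theta - mean P) ord0 j.
    have /subspace_continuousP/(_ P PPP) := Lp1_mean_continuous (X1 j).
    rewrite (_ : (fun Q => (theta - mean Q) ord0 j) =
      (fun Q => theta ord0 j - \int[Q]_w X w ord0 j)); last first.
      by apply/funext => Q; rewrite !mxE fine_expectation.
    rewrite !mxE fine_expectation => cj.
    by apply: cvgB cj; exact: cvg_cst.
  by move=> cj; exact: cvgM.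
have [P PPP Pmin] :=
  @compact_EVT_min W R _ (PP : set W) (representing_set_neq0 E_repr) PP_compact c.
by exists P => [|Q PPQ]; [exact: set_mem|apply: Pmin; exact: mem_set].
Qed.

(** Separation without Hahn-Banach: if [P] gives the mean nearest to [theta],
    convexity makes [p = theta - mean P] satisfy [<p, mean Q> <= <p, mean P>]
    for all [Q], so that [theta] in [Theta] forces [<p, p> <= 0]. *)
Lemma Theta_mean theta : Theta E X theta -> exists2 P, PP P & mean P = theta.
Proof.
move=> Th; have [P PPP Pmin] := nearest_mean theta; exists P => //.
pose p := theta - mean P.
have sep Q : PP Q -> dotp p (mean Q) <= dotp p (mean P).
  move=> PPQ; rewrite -subr_le0 -dotpBr; set v := mean Q - mean P.
  (* Moving from [mean P] towards [mean Q] by [s] cannot come nearer to [theta]. *)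
  have quad s : 0 < s -> s <= 1 -> 2 * dotp p v <= s * dotp v v.
    move=> s0 s1.
    have t01 : 0 <= 1 - s <= 1 by lra.
    have [S PPS Sm] := mean_mixture PPP PPQ t01.
    have := Pmin S PPS; rewrite /sqdist Sm.
    rewrite (_ : 1 - (1 - s) = s); last by ring.
    rewrite -/v opprD addrA -/p dotp_subZ => h.
    have : 0 <= s * (s * dotp v v - 2 * dotp p v) by lra.
    by rewrite pmulr_rge0// subr_ge0.
  apply/ler_addgt0Pr => e e0; rewrite add0r.
  have v0 : 0 <= dotp v v.
    by apply: sumr_ge0 => j _; rewrite -expr2 sqr_ge0.
  (* Let [s] tend to [0] in [quad]: the value [s = e / (<v, v> + e)] makes the
     right-hand side at most [e]. *)
  have D0 : 0 < dotp v v + e by rewrite ltr_wpDl.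
  have [ee|ee] := leP (e / (dotp v v + e)) 1; last first.
    by move: ee; rewrite ltr_pdivlMr// mul1r; lra.
  have := quad _ (divr_gt0 e0 D0) ee.
  have : e / (dotp v v + e) * dotp v v <= e.
    by rewrite mulrAC ler_pdivrMr// ler_pM2l// lerDl ltW.
  lra.
have Ep : E (fun w => dotp p (X w)) <= dotp p (mean P).
  apply: (E_le_of_means E_repr E_ext (Lp1_dotp p)) => Q PPQ.
  by rewrite mean_dotp// sep.
have : dotp p p <= 0.
  by rewrite {2}/p dotpBr subr_le0 dotpC (le_trans (Th p)).
by move=> /dotp_eq0/eqP; rewrite subr_eq0 => /eqP.
Qed.

Lemma Theta_means : Theta E X = [set mean P | P in PP].
Proof.
apply/seteqP; split=> [theta /Theta_mean[P PPP <-]|_ [P PPP <-]].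
  by exists P.
exact: mean_in_Theta.
Qed.

End set_of_means.

(** * Approximation of past events by Lipschitz functions of the past *)

Section infimal_convolution.
Context (R : realType) (m : nat).
Variable U : set 'rV[R]_m.

(** The largest [k]-Lipschitz function below the indicator of [U]: for open [U]
    these functions reach the indicator at every point as [k] grows. Unlike a
    distance to the complement, the infimum also makes sense when [U] is the
    whole space. *)
Definition lip_indic (k : R) (x : 'rV[R]_m) : R :=
  inf [set \1_U y + k * l1dist x y | y in [set: 'rV[R]_m]].

Variable k : R.
Hypothesis k0 : 0 <= k.

Let indic_ge0 (y : 'rV[R]_m) : 0 <= \1_U y :> R.
Proof. by rewrite indicE ler0n. Qed.

Let lip_indic_lb x :
  lbound [set \1_U y + k * l1dist x y | y in [set: 'rV[R]_m]] 0.
Proof. by move=> _ [y _ <-]; rewrite addr_ge0// mulr_ge0// l1dist_ge0. Qed.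

Lemma lip_indic_le x y : lip_indic k x <= \1_U y + k * l1dist x y.
Proof. by apply: ge_inf; [exists 0; exact: lip_indic_lb|exists y]. Qed.

Lemma le_lip_indic x c :
  (forall y, c <= \1_U y + k * l1dist x y) -> c <= lip_indic k x.
Proof.
move=> cx; apply: lb_le_inf; first by exists (\1_U x + k * l1dist x x), x.
by move=> _ [y _ <-].
Qed.

Lemma lip_indic_ge0 x : 0 <= lip_indic k x.
Proof.
by apply: le_lip_indic => y; rewrite addr_ge0// mulr_ge0// l1dist_ge0.
Qed.

Lemma lip_indic_le_indic x : lip_indic k x <= \1_U x.
Proof. by have := lip_indic_le x x; rewrite l1distxx mulr0 addr0. Qed.

Lemma lip_indic_le1 x : lip_indic k x <= 1.
Proof.
apply: (le_trans (lip_indic_le_indic x)).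
by rewrite indicE lern1 leq_b1.
Qed.

Lemma lip_indic_lipschitz : l1_lipschitz k (lip_indic k).
Proof.
have half x y : lip_indic k x - lip_indic k y <= k * l1dist x y.
  rewrite lerBlDr -lerBlDl; apply: le_lip_indic => z.
  rewrite lerBlDl (le_trans (lip_indic_le x z))// addrCA lerD2l -mulrDr.
  by rewrite ler_wpM2l// l1dist_triangle.
move=> x y; rewrite ler_norml; apply/andP; split; last exact: half.
by rewrite lerNl opprB l1distC.
Qed.

End infimal_convolution.

(** At a point of [U] at distance at least [e] from the complement, the value is
    [1] as soon as [k * e >= 1]. *)
Lemma lip_indic_eventually (R : realType) m (U : set 'rV[R]_m) x : open U ->
  \forall k \near \oo, lip_indic U k%:R x = \1_U x.
Proof.
move=> oU; have [Ux|Ux] := pselect (U x); last first.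
  apply: nearW => k; apply/eqP; rewrite eq_le lip_indic_le_indic ?ler0n//.
  by rewrite indicE memNset// lip_indic_ge0 ?ler0n.
have /nbhs_rVP[e e0 eU] := open_nbhs_nbhs (conj oU Ux).
near=> k; apply/eqP; rewrite eq_le lip_indic_le_indic ?ler0n//=.
rewrite {1}indicE mem_set//=; apply: le_lip_indic => y.
have [Uy|Uy] := pselect (U y).
  by rewrite indicE mem_set// lerDl mulr_ge0// l1dist_ge0.
rewrite indicE memNset//= add0r.
have ed : e <= l1dist x y.
  rewrite leNgt; apply/negP => xy; apply: Uy; apply: eU => j.
  exact: le_lt_trans (coord_le_l1dist x y j) xy.
rewrite (@le_trans _ _ (k%:R * e))//; last by rewrite ler_wpM2l.
rewrite -ler_pdivrMr// mul1r; near: k; exact: nbhs_infty_ger.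
Unshelve. all: by end_near. Qed.

Lemma ler_dist_max (R : realDomainType) (a b c d : R) :
  `|Num.max a b - Num.max c d| <= `|a - c| + `|b - d|.
Proof.
have h (x y z t : R) : Num.max x y - Num.max z t <= `|x - z| + `|y - t|.
  have xz := ler_norm (x - z); have yt := ler_norm (y - t).
  have n1 := normr_ge0 (x - z); have n2 := normr_ge0 (y - t).
  have zm : z <= Num.max z t by rewrite le_max lexx.
  have tm : t <= Num.max z t by rewrite le_max lexx orbT.
  by rewrite lerBlDr ge_max; apply/andP; split; lra.
by rewrite ler_norml lerNl opprB h [`|a - c|]distrC [`|b - d|]distrC h.
Qed.

Section approximable_events.
Context d (T : measurableType d) (R : realType) (P : probability T R).
Variables (m : nat) (Z : T -> 'rV[R]_m).
Hypothesis mZ : forall j, measurable_fun [set: T] (fun w => Z w ord0 j).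

Definition Lipschitz_cutoff (phi : 'rV[R]_m -> R) :=
  (forall x, 0 <= phi x <= 1) /\ exists2 k, 0 <= k & l1_lipschitz k phi.

(** Independence yields inequalities tested against nonnegative Lipschitz
    functions of [Z]. Such an inequality does not pass from an event to its
    complement, so the family of events satisfying it need not be a
    sigma-algebra; the family of events approximable in mean by cutoffs is one. *)
Definition approximable_event (A : set T) := measurable A /\
  forall e, 0 < e -> exists2 phi, Lipschitz_cutoff phi &
    \int[P]_w `|phi (Z w) - \1_A w| <= e.

Lemma cutoff_integrable phi : Lipschitz_cutoff phi ->
  P.-integrable [set: T] (EFin \o (fun w => phi (Z w))).
Proof.
move=> [phi01 [k k0 lip]].
apply: (@bounded_integrable _ _ _ P 1); first exact: measurable_l1_lipschitz_comp lip.
by move=> w; rewrite ger0_norm; case/andP: (phi01 (Z w)).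
Qed.

Lemma cutoff_dist_integrable phi A : Lipschitz_cutoff phi -> measurable A ->
  P.-integrable [set: T] (EFin \o (fun w => `|phi (Z w) - \1_A w|)).
Proof.
move=> cphi mA; apply: (@integrable_norm _ _ _ P _ (fun w => phi (Z w) - \1_A w)).
exact: (integrable_sub (cutoff_integrable cphi) (indic_integrable P mA)).
Qed.

Lemma approximable_set0 : approximable_event set0.
Proof.
split=> // e e0; exists (cst 0).
  split=> [x|]; first by rewrite lexx ler01.
  by exists 0 => // x y; rewrite subrr normr0 mul0r.
under eq_Rintegral do rewrite indic0 /= subr0 normr0.
by rewrite Rintegral_cst_prob ltW.
Qed.

Lemma approximable_setC A : approximable_event A -> approximable_event (~` A).
Proof.
move=> [mA aA]; split=> [|e /aA[phi [phi01 [k k0 lip]] le]].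
  exact: measurableC.
exists (fun x => 1 - phi x).
  split=> [x|]; first by have := phi01 x; lra.
  exists k => // x y; rewrite [X in `|X|](_ : _ = phi y - phi x); last by ring.
  by rewrite l1distC.
rewrite (_ : (\int[P]_w _)%R = \int[P]_w `|phi (Z w) - \1_A w|) ?le//.
apply: eq_Rintegral => w _; rewrite !indicE in_setC; case: (w \in A) => /=.
  by rewrite subr0 distrC.
by rewrite subr0 addrAC subrr add0r normrN.
Qed.

Lemma approximable_setU A B : approximable_event A -> approximable_event B ->
  approximable_event (A `|` B).
Proof.
move=> [mA aA] [mB aB]; split=> [|e e0]; first exact: measurableU.
have e20 : 0 < e / 2 by rewrite divr_gt0.
have [phi cphi lephi] := aA _ e20; have [psi cpsi lepsi] := aB _ e20.
have [phi01 [k k0 lipk]] := cphi; have [psi01 [l l0 lipl]] := cpsi.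
have cmax : Lipschitz_cutoff (fun x => Num.max (phi x) (psi x)).
  split=> [x|].
    have /andP[? ?] := phi01 x; have /andP[? ?] := psi01 x.
    by rewrite le_max ge_max; apply/andP; split; [apply/orP; left|apply/andP].
  exists (k + l) => [|x y]; first exact: addr_ge0.
  by rewrite (le_trans (ler_dist_max _ _ _ _))// mulrDl lerD.
exists (fun x => Num.max (phi x) (psi x)) => //.
have dA := cutoff_dist_integrable cphi mA.
have dB := cutoff_dist_integrable cpsi mB.
apply: (@le_trans _ _
    (\int[P]_w (`|phi (Z w) - \1_A w| + `|psi (Z w) - \1_B w|))).
  apply: le_Rintegral => //.
  - exact: (cutoff_dist_integrable cmax (measurableU _ _ mA mB)).
  - exact: integrable_add.
  - move=> w _; have -> : \1_(A `|` B) w = Num.max (\1_A w) (\1_B w) :> R.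
      rewrite !indicE in_setU; case: (w \in A); case: (w \in B) => /=.
      + by rewrite maxxx.
      + by rewrite max_l.
      + by rewrite max_r.
      + by rewrite maxxx.
    exact: ler_dist_max.
by rewrite RintegralD//; lra.
Qed.

(** By continuity from below, a countable union is close in probability to one of
    its finite subunions. *)
Lemma approximable_bigcup (F : (set T)^nat) :
  (forall n, approximable_event (F n)) -> approximable_event (\bigcup_n F n).
Proof.
move=> aF; pose G n := \big[setU/set0]_(i < n.+1) F i.
have aG n : approximable_event (G n).
  elim: n => [|n IHn]; first by rewrite /G big_ord1.
  by rewrite /G big_ord_recr/=; exact: approximable_setU.
have mF n : measurable (F n) := (aF n).1.
have mUF : measurable (\bigcup_n F n) by exact: bigcupT_measurable.
split=> // e e0; have e20 : 0 < e / 2 by rewrite divr_gt0.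
have UG : \bigcup_n F n = \bigcup_n G n by rewrite bigcup_bigsetU_bigcup.
have [n Gn] : exists n, fine (P (\bigcup_n F n)) - fine (P (G n)) <= e / 2.
  have : P (G k) @[k --> \oo] --> P (\bigcup_n F n).
    rewrite UG; apply: nondecreasing_cvg_mu => [k||].
    - exact: (aG k).1.
    - by rewrite -UG.
    - apply/nondecreasing_seqP => k; apply/subsetPset.
      by rewrite {2}/G big_ord_recr/=; exact: subsetUl.
  rewrite -[X in _ --> X]fineK ?fin_num_measure// => /fine_cvg.
  move=> /cvgrPdist_le /(_ _ e20) near_e.
  have [k /= ke] := filter_ex near_e; exists k.
  by apply: le_trans ke; exact: ler_norm.
have [phi cphi le] := (aG n).2 _ e20; exists phi => //.
have mG := (aG n).1.
have GF : G n `<=` \bigcup_n F n by rewrite UG; exact: bigcup_sup.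
have ind_le w : \1_(G n) w <= \1_(\bigcup_n F n) w :> R.
  rewrite !indicE ler_nat; case: (boolP (w \in G n)) => // /set_mem/GF/mem_set->.
  by [].
have i1 := cutoff_dist_integrable cphi mG.
have i2 := integrable_sub (indic_integrable P mUF) (indic_integrable P mG).
apply: (@le_trans _ _ (\int[P]_w
   (`|phi (Z w) - \1_(G n) w| + (\1_(\bigcup_n F n) w - \1_(G n) w)))).
  apply: le_Rintegral => //.
  - exact: cutoff_dist_integrable.
  - exact: integrable_add.
  - move=> w _; rewrite (le_trans (ler_distD (\1_(G n) w) _ _))// lerD2l.
    by rewrite distrC ger0_norm// subr_ge0.
rewrite RintegralD// RintegralB//; last 2 first.
- exact: indic_integrable.
- exact: indic_integrable.
by rewrite !Rintegral_indic//; lra.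
Qed.

Lemma approximable_sigma_algebra : sigma_algebra setT approximable_event.
Proof.
split=> [|A aA|F]; first exact: approximable_set0.
  by rewrite setTD; exact: approximable_setC.
exact: approximable_bigcup.
Qed.

(** Dominated convergence along the Lipschitz minorants of the indicator. *)
Lemma approximable_open_preimage n (pr : 'rV[R]_m -> 'rV[R]_n) (K : R) U :
  0 <= K -> (forall x y, l1dist (pr x) (pr y) <= K * l1dist x y) ->
  open U -> approximable_event ((fun w => pr (Z w)) @^-1` U).
Proof.
move=> K0 lip oU; set A := _ @^-1` U.
have mprZ j : measurable_fun [set: T] (fun w => pr (Z w) ord0 j).
  apply: (@measurable_l1_lipschitz_comp _ _ _ _ Z mZ K (fun x => pr x ord0 j)).
  by move=> x y; rewrite (le_trans _ (lip x y))// coord_le_l1dist.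
have mA : measurable A by exact: measurable_preimage_open.
split=> // e e0; pose phi (k : nat) x := lip_indic U k%:R (pr x).
have cphi k : Lipschitz_cutoff (phi k).
  split=> [x|]; first by rewrite lip_indic_ge0 ?lip_indic_le1.
  exists (k%:R * K) => [|x y]; first exact: mulr_ge0.
  rewrite (le_trans (lip_indic_lipschitz _ (ler0n _ k) _ _))// -mulrA.
  by rewrite ler_wpM2l.
have i0 k := cutoff_dist_integrable (cphi k) mA.
have phi_cvg w : [set: T] w ->
    (`|phi k (Z w) - \1_A w|)%:E @[k --> \oo] --> (cst 0%E : T -> \bar R) w.
  move=> _; apply: cvg_near_cst.
  have := lip_indic_eventually (pr (Z w)) oU; apply: filterS => k.
  by rewrite /phi => ->; rewrite -[\1_U _]/(\1_A w) subrr normr0.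
have phi_le1 w k : [set: T] w -> (`|(`|phi k (Z w) - \1_A w|)%:E| <= 1)%E.
  move=> _; rewrite /= lee_fin normr_id ler_norml.
  have [phi01 _] := cphi k; have /andP[? ?] := phi01 (Z w).
  by rewrite indicE; case: (w \in A) => /=; apply/andP; split; lra.
have cst1_integrable : P.-integrable setT (cst 1%E : T -> \bar R).
  by apply: (@bounded_integrable _ _ _ P 1 (cst 1)) => // w; rewrite normr1.
have [_ _ cvgf] := @dominated_convergence _ T R P setT measurableT
  (fun k w => (`|phi k (Z w) - \1_A w|)%:E) (cst 0%E) (cst 1%E)
  (fun k => measurable_int P (i0 k)) (measurable_cst _)
  (aeW P phi_cvg) cst1_integrable (aeW P phi_le1).
have := cvgf; rewrite integral_cst// mul0e => {}cvgf.
have : \forall k \near \oo, (\int[P]_w (`|phi k (Z w) - \1_A w|)%:E < e%:E)%E.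
  apply: (cvgf [set x : \bar R | (x < e%:E)%E]).
  by apply: open_ereal_lt'; rewrite lte_fin.
move=> /filter_ex[k ke]; exists (phi k) => //.
rewrite -lee_fin /Rintegral fineK ?(ltW ke)//.
exact: integrable_fin_num (i0 k).
Qed.

End approximable_events.

Section past_events.
Context (R : realType) (Omega : completeMetricType R).
Context (d n : nat) (X : 'I_n -> Omega -> 'rV[R]_d) (i : 'I_n).

Definition past_block (k : 'I_i) (v : 'rV[R]_(i * d)) : 'rV[R]_d :=
  row k (vec_mx v).

Lemma past_blockE k w :
  past_block k (past X i w) = X (widen_ord (ltnW (ltn_ord i)) k) w.
Proof. by rewrite /past_block /past mxvecK rowK. Qed.

Lemma past_block_lipschitz k x y :
  l1dist (past_block k x) (past_block k y) <= d%:R * l1dist x y.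
Proof. by apply: ord_sum_le => j; rewrite !mxE; exact: coord_le_l1dist. Qed.

Lemma past_coord (j : 'I_(i * d)) : exists k l,
  (fun w => past X i w ord0 j) = (fun w => X k w ord0 l).
Proof.
case/mxvec_indexP: j => k l; exists (widen_ord (ltnW (ltn_ord i)) k), l.
by apply/funext => w; rewrite /past mxvecE mxE.
Qed.

Variable P : probability (borel Omega) R.
Hypothesis mX : forall k j,
  measurable_fun [set: borel Omega] (fun w => X k w ord0 j).

(** The past sigma-algebra is generated in two stages: by preimages under the
    [X k] of Borel sets, which are themselves generated by the open sets. *)
Lemma past_approximable A : past_sigma X i A ->
  approximable_event P (past X i : borel Omega -> _) A.
Proof.
have mpast j : measurable_fun [set: borel Omega] (fun w => past X i w ord0 j).
  by have [k [l ->]] := past_coord j; exact: mX.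
have [a0 aC aU] := approximable_sigma_algebra P mpast.
apply: smallest_sub; first exact: (approximable_sigma_algebra P mpast).
move=> _ [k [ki [B sB ->]]].
have Xk : X k = (fun w => past_block (Ordinal ki) (past X i w)).
  by apply/funext => w; rewrite past_blockE; congr (X _ w); exact: val_inj.
rewrite Xk; move: B sB; apply: smallest_sub => [|U oU /=].
  split => /= [|B aB|F aF].
  - by rewrite preimage_set0.
  - by rewrite setTD preimage_setC -setTD; exact: aC.
  - by rewrite preimage_bigcup; exact: aU.
exact: (approximable_open_preimage P mpast (ler0n R d)
  (past_block_lipschitz (Ordinal ki))).
Qed.

End past_events.

(** * One-step inequality from independence *)

Section clamp.
Context (R : realType).

Definition clamp (M t : R) := if t < - M then - M else if M < t then M else t.

Lemma clamp_le M t : 0 <= M -> `|clamp M t| <= M.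
Proof.
move=> M0; rewrite /clamp ler_norml.
by case: ltP => ?; last case: ltP => ?; apply/andP; split; lra.
Qed.

Lemma clamp_lipschitz M s t : 0 <= M -> `|clamp M s - clamp M t| <= `|s - t|.
Proof.
move=> M0; have h x y : clamp M x - clamp M y <= `|x - y|.
  have := ler_norm (x - y); have := normr_ge0 (x - y); rewrite /clamp.
  by do 2 (case: ltP => ?; last case: ltP => ?); lra.
by rewrite ler_norml h lerNl opprB distrC h.
Qed.

(** [clamp M] is the nearest-point projection onto [[-M, M]]. *)
Lemma clamp_dist M t u : `|u| <= M -> `|clamp M t - t| <= `|u - t|.
Proof.
rewrite ler_norml => /andP[u1 u2].
have := ler_norm (u - t); have := ler_norm (t - u); rewrite (distrC t u).
rewrite /clamp ler_norml.
by case: ltP => ?; last case: ltP => ?; move=> ? ?; apply/andP; split; lra.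
Qed.

End clamp.

Section one_step.
Context (R : realType) (Omega : completeMetricType R).
Variables (E : (Omega -> R) -> R) (PP : set (probability (borel Omega) R)).
Hypothesis E_sublinear : regular_sublinear E.
Hypothesis E_repr : forall X, CbLip Omega X -> (E X)%:E = upper_expectation PP X.
Hypothesis E_ext : L1_extended PP E.

Let PP0 := representing_set_neq0 E_repr.

(** Positive homogeneity and translation invariance, known for [E] on bounded
    Lipschitz functions, hold on L^1 because suprema of means have them. *)
Lemma E_scaled_centered f a : 0 <= a -> Lp PP 1 f ->
  Lp PP 1 (fun w => a * (f w - E f)) -> E (fun w => a * (f w - E f)) = 0.
Proof.
move=> a0 f1 g1.
have meang P : PP P ->
    \int[P]_w (a * (f w - E f)) = a * (\int[P]_w f w - E f).
  move=> PPP; have fi := Lp1_integrable f1 PPP.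
  have ci : P.-integrable [set: borel Omega] (EFin \o (fun _ => E f)).
    exact: (CbLip_integrable P (CbLip_cst Omega (E f))).
  rewrite RintegralZl//; last exact: integrable_sub.
  by rewrite RintegralB// Rintegral_cst_prob.
apply/eqP; rewrite eq_le; apply/andP; split.
  apply: (E_le_of_means E_repr E_ext g1) => P PPP.
  rewrite meang// mulr_ge0_le0// subr_le0.
  exact: (mean_le_E E_repr E_ext f1).
have [az|aN0] := eqVneq a 0.
  have [P PPP] := PP0.
  by have := mean_le_E E_repr E_ext g1 PPP; rewrite meang// {1}az mul0r.
have {aN0}a0 : 0 < a by rewrite lt_neqAle eq_sym aN0.
have ai0 : 0 < a^-1 by rewrite invr_gt0.
rewrite -(pmulr_rge0 _ ai0).
rewrite -(lerD2l (E f)) addr0.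
apply: (E_le_of_means E_repr E_ext f1) => P PPP.
rewrite -lerBlDl ler_pdivlMl// -meang//.
exact: (mean_le_E E_repr E_ext g1).
Qed.

Lemma CbLip_rV_mul_centered d1 d2 (phi : 'rV[R]_d1 -> R) (psi : 'rV[R]_d2 -> R) c :
  CbLip_rV phi -> CbLip_rV psi ->
  CbLip_rV (fun v : 'rV[R]_(d1 + d2) =>
    phi (lsubmx v) * (psi (rsubmx v) - c)).
Proof.
move=> /CbLip_rVP[[M phiM] [k k0 lipk]] /CbLip_rVP[[N psiN] [l l0 lipl]].
have M0 : 0 <= M by exact: le_trans (normr_ge0 _) (phiM 0).
have N0 : 0 <= N by exact: le_trans (normr_ge0 _) (psiN 0).
have psic y : `|psi y - c| <= N + `|c|.
  by rewrite (le_trans (ler_normB _ _))// lerD2r.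
have Nc0 : 0 <= N + `|c| by exact: addr_ge0.
apply/CbLip_rVP; split.
  by exists (M * (N + `|c|)) => v; rewrite normrM ler_pM.
exists (k * (N + `|c|) + M * l) => [|v v'].
  by rewrite addr_ge0// mulr_ge0.
rewrite -[v in l1dist v _]hsubmxK -[v' in l1dist _ v']hsubmxK l1dist_row_mx.
set x := lsubmx v; set x' := lsubmx v'; set y := rsubmx v; set y' := rsubmx v'.
have -> : phi x * (psi y - c) - phi x' * (psi y' - c) =
    (phi x - phi x') * (psi y - c) + phi x' * (psi y - psi y') by ring.
rewrite (le_trans (ler_normD _ _))// !normrM.
have D1 := l1dist_ge0 x x'; have D2 := l1dist_ge0 y y'.
apply: (@le_trans _ _ (k * l1dist x x' * (N + `|c|) + M * (l * l1dist y y'))).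
  by apply: lerD; apply: ler_pM.
rewrite -subr_ge0 (_ : _ - _ =
  k * (N + `|c|) * l1dist y y' + M * l * l1dist x x'); last by ring.
by rewrite addr_ge0// !mulr_ge0.
Qed.

Variables (d1 d2 : nat) (Z : Omega -> 'rV[R]_d1) (Y : Omega -> 'rV[R]_d2).
Hypothesis Z1 : forall j, Lp PP 1 (fun w => Z w ord0 j).
Hypothesis Y1 : forall j, Lp PP 1 (fun w => Y w ord0 j).
Hypothesis ZY : independent_of E Y Z.

Lemma Lp1_CbLip_rV m (V : Omega -> 'rV[R]_m) psi :
  (forall j, Lp PP 1 (fun w => V w ord0 j)) -> CbLip_rV psi ->
  Lp PP 1 (fun w => psi (V w)).
Proof.
by move=> V1 /CbLip_rVP[_ [k k0 lip]];
  exact: (Lp1_l1_lipschitz_comp PP0 k0 lip V1).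
Qed.

(** Freezing the past value [x = Z], the inner expectation of
    [phi x * (psi Y - E (psi Y))] vanishes because [phi x >= 0]. *)
Lemma independence_mean_le0 phi psi P : CbLip_rV phi -> (forall x, 0 <= phi x) ->
  CbLip_rV psi -> PP P ->
  \int[P]_w (phi (Z w) * (psi (Y w) - E (fun w => psi (Y w)))) <= 0.
Proof.
move=> Lphi phi0 Lpsi PPP; set c := E _.
pose g (v : 'rV[R]_(d1 + d2)) := phi (lsubmx v) * (psi (rsubmx v) - c).
have Lg : CbLip_rV g by exact: CbLip_rV_mul_centered.
have gE x y : g (row_mx x y) = phi x * (psi y - c).
  by rewrite /g row_mxKl row_mxKr.
have ZY1 j : Lp PP 1 (fun w => row_mx (Z w) (Y w) ord0 j).
  case: (split_ordP j) => k ->.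
    under eq_fun do rewrite row_mxEl; exact: Z1.
  under eq_fun do rewrite row_mxEr; exact: Y1.
have g1 : Lp PP 1 (fun w => g (row_mx (Z w) (Y w))) by exact: Lp1_CbLip_rV.
have Eg : E (fun w => g (row_mx (Z w) (Y w))) = 0.
  rewrite ZY//= (_ : (fun w => E _) = cst 0); first exact: sublin_cst.
  apply/funext => w; under [X in E X]eq_fun do rewrite gE.
  have psi1 := Lp1_CbLip_rV Y1 Lpsi.
  apply: (E_scaled_centered (phi0 (Z w)) psi1).
  have [b [k k0 lip]] := (CbLip_rVP psi).1 Lpsi.
  apply: (@Lp1_l1_lipschitz_comp _ _ PP PP0 _ (phi (Z w) * k)
    (fun y => phi (Z w) * (psi y - c)) Y) => //; first exact: mulr_ge0.
  move=> x y; rewrite -mulrBr normrM ger0_norm// -mulrA ler_wpM2l//.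
  by rewrite (_ : _ - _ = psi x - psi y); [exact: lip|ring].
have <- : \int[P]_w g (row_mx (Z w) (Y w)) =
    \int[P]_w (phi (Z w) * (psi (Y w) - c)).
  by apply: eq_Rintegral => w _; rewrite gE.
by rewrite -Eg; exact: (mean_le_E E_repr E_ext g1).
Qed.

Variable P : probability (borel Omega) R.
Hypothesis PPP : PP P.
Variable A : set Omega.
Hypothesis aA : approximable_event P (Z : borel Omega -> _) A.

Let mZ j : measurable_fun [set: borel Omega] (fun w => Z w ord0 j) := (Z1 j).1.

(** Replacing [phi Z] by [1_A] changes the mean by at most [N] times the mean of
    [|phi Z - 1_A|], where [N] bounds the centered factor. *)
Lemma event_mean_le0 psi : CbLip_rV psi ->
  \int[P]_w (\1_A w * (psi (Y w) - E (fun w => psi (Y w)))) <= 0.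
Proof.
move=> Lpsi; set c := E _.
have [[M psiM] _] := (CbLip_rVP psi).1 Lpsi.
have psi1 := Lp1_CbLip_rV Y1 Lpsi.
have fi : P.-integrable [set: borel Omega] (EFin \o (fun w => psi (Y w) - c)).
  apply: integrable_sub; first exact: Lp1_integrable psi1 PPP.
  exact: (CbLip_integrable P (CbLip_cst Omega c)).
have M0 : 0 <= M by exact: le_trans (normr_ge0 _) (psiM 0).
pose N := M + `|c| + 1.
have N0 : 0 < N by rewrite ltr_wpDl// addr_ge0.
have fN w : `|psi (Y w) - c| <= N.
  by rewrite (le_trans (ler_normB _ _))// /N -addrA lerD// lerDl.
apply/ler_addgt0Pr => e e0; rewrite add0r.
have [phi cphi le] := aA.2 _ (divr_gt0 e0 N0).
have [phi01 [k k0 lip]] := cphi.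
have phi0 x : 0 <= phi x by case/andP: (phi01 x).
have Lphi : CbLip_rV phi.
  apply/CbLip_rVP; split; last by exists k.
  by exists 1 => x; rewrite ger0_norm//; case/andP: (phi01 x).
have di := cutoff_dist_integrable P mZ cphi aA.1.
have phifi : P.-integrable [set: borel Omega]
    (EFin \o (fun w => phi (Z w) * (psi (Y w) - c))).
  apply: le_integrable (fi) => //.
    apply/measurable_EFinP; apply: measurable_funM.
      exact: (measurable_l1_lipschitz_comp mZ lip).
    by apply/measurable_EFinP; exact: measurable_int fi.
  move=> w _; rewrite /= lee_fin normrM ler_piMl// ger0_norm//.
  by case/andP: (phi01 (Z w)).
apply: (@le_trans _ _ (\int[P]_w
    (phi (Z w) * (psi (Y w) - c) + N * `|phi (Z w) - \1_A w|))).
  apply: le_Rintegral => //.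
  - exact: (integrable_indic_mul aA.1).
  - by apply: integrable_add => //; exact: integrable_scale.
  - move=> w _; rewrite -lerBlDl -mulrBl (le_trans (ler_norm _))//.
    by rewrite normrM mulrC [`|\1_A w - _|]distrC ler_wpM2r.
rewrite RintegralD//; last exact: integrable_scale.
rewrite RintegralZl//.
have := independence_mean_le0 Lphi phi0 Lpsi PPP; rewrite -/c => h.
have : N * \int[P]_w `|phi (Z w) - \1_A w| <= e.
  by rewrite mulrC -ler_pdivlMr.
by lra.
Qed.

(** Truncating [<p, Y>] at the bound [M] of a bounded Lipschitz approximation
    [u] costs no more than the approximation itself. *)
Lemma event_mean_dotp_le p :
  \int[P]_w (\1_A w * dotp p (Y w)) <=
  fine (P A) * E (fun w => dotp p (Y w)).
Proof.
have H1 := Lp1_dotp E_repr Y1 p; set H := fun w => dotp p (Y w).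
have mA := aA.1.
have PA0 : 0 <= fine (P A) by rewrite fine_ge0.
have PA1 : fine (P A) <= 1.
  by rewrite -lee_fin fineK ?fin_num_measure// probability_le1.
apply/ler_addgt0Pr => e e0; have e20 : 0 < e / 2 by rewrite divr_gt0.
have [u [[M uM] uL] uH] := Lp1_approximable H1 e20.
have M0 : 0 <= M by exact: le_trans (normr_ge0 _) (uM point).
pose psi y := clamp M (dotp p y).
have Lpsi : CbLip_rV psi.
  apply/CbLip_rVP; split; first by exists M => y; exact: clamp_le.
  exists (\sum_j `|p ord0 j|) => [|x y]; first exact: sumr_ge0.
  exact: le_trans (clamp_lipschitz _ _ M0) (dotp_l1_lipschitz p x y).
have psi1 := Lp1_CbLip_rV Y1 Lpsi.
have close Q : PP Q -> Q.-integrable [set: borel Omega]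
      (EFin \o (fun w => `|psi (Y w) - H w|)) /\
    \int[Q]_w `|psi (Y w) - H w| <= e / 2.
  move=> PPQ; have [ui ule] := uH Q PPQ.
  have pHi := integrable_sub (Lp1_integrable psi1 PPQ) (Lp1_integrable H1 PPQ).
  have pHi' := integrable_norm pHi; split=> //; apply: le_trans ule.
  apply: le_Rintegral => //; first exact: integrable_norm ui.
  by move=> w _; exact: clamp_dist.
have Epsi : E (fun w => psi (Y w)) <= E H + e / 2.
  apply: (E_le_of_means E_repr E_ext psi1) => Q PPQ.
  have := Rintegral_close (Lp1_integrable psi1 PPQ) (Lp1_integrable H1 PPQ)
    (close Q PPQ).2.
  have := mean_le_E E_repr E_ext H1 PPQ.
  by rewrite ler_norml => ? /andP[? ?]; lra.
have psii := Lp1_integrable psi1 PPP.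
have [di dle] := close P PPP.
have ind : \int[P]_w (\1_A w * psi (Y w)) <= fine (P A) * E (fun w => psi (Y w)).
  have := event_mean_le0 Lpsi; set c := E _ => h.
  rewrite -subr_le0; apply: le_trans h.
  rewrite (_ : (\int[P]_w (_ * (_ - _)))%R =
    \int[P]_w (\1_A w * psi (Y w) - c * \1_A w)); last first.
    by apply: eq_Rintegral => w _; ring.
  rewrite RintegralB//; last 2 first.
  - exact: (integrable_indic_mul aA.1).
  - by apply: integrable_scale; exact: indic_integrable.
  by rewrite RintegralZl ?Rintegral_indic// 1?mulrC//; exact: indic_integrable.
apply: (@le_trans _ _ (\int[P]_w (\1_A w * psi (Y w) + `|psi (Y w) - H w|))).
  apply: le_Rintegral => //.
  - exact: (integrable_indic_mul aA.1 (Lp1_integrable H1 PPP)).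
  - by apply: integrable_add => //; exact: (integrable_indic_mul aA.1).
  - move=> w _; rewrite indicE; case: (w \in A); rewrite ?mul1r ?mul0r ?add0r//.
    by rewrite -lerBlDl distrC ler_norm.
rewrite RintegralD//; last exact: (integrable_indic_mul aA.1).
have : fine (P A) * E (fun w => psi (Y w)) <= fine (P A) * E H + e / 2.
  rewrite (le_trans (ler_wpM2l PA0 Epsi))// mulrDr lerD2l.
  by rewrite ler_piMl// ltW.
by lra.
Qed.

End one_step.

(** * From one-step inequalities to conditional means *)

Section almost_sure.
Context d (T : measurableType d) (R : realType) (P : probability T R).

Lemma ae_eq0_of_mean_le0 (f : T -> R) : P.-integrable [set: T] (EFin \o f) ->
  (forall w, 0 <= f w) -> \int[P]_w f w <= 0 -> {ae P, forall w, f w = 0}.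
Proof.
move=> fi f0 fle.
have int0 : (\int[P]_w `|(EFin \o f) w| = 0)%E.
  under eq_integral do rewrite /= ger0_norm//.
  rewrite -[LHS]fineK; last exact: integrable_fin_num fi.
  by congr EFin; apply/eqP; rewrite eq_le fle Rintegral_ge0.
have := (ae_eq_integral_abs P measurableT (measurable_int P fi)).1 int0.
by apply: filterS => w /(_ I) [].
Qed.

End almost_sure.

Lemma rational_approximation (R : realType) m (p : 'rV[R]_m) (e : R) : 0 < e ->
  exists q : 'rV[rat]_m, forall j, `|ratr (q ord0 j) - p ord0 j| <= e.
Proof.
move=> e0.
have Hq j : exists q : rat, `|ratr q - p ord0 j| <= e.
  have [q] : exists q : rat, ratr q \in `](p ord0 j - e), (p ord0 j + e)[.
    by apply: rat_in_itvoo; rewrite ltrD2l gtrN.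
  rewrite in_itv/= => /andP[q1 q2].
  by exists q; rewrite ler_norml; apply/andP; split; lra.
have [q qP] := choice Hq.
by exists (\row_j q j) => j; rewrite mxE.
Qed.

Section conditional_means.
Context (R : realType) (Omega : completeMetricType R).
Variables (E : (Omega -> R) -> R) (PP : set (probability (borel Omega) R)).
Hypothesis E_repr : forall X, CbLip Omega X -> (E X)%:E = upper_expectation PP X.
Hypothesis E_ext : L1_extended PP E.
Variables (m : nat) (X : Omega -> 'rV[R]_m).
Hypothesis X1 : forall j, Lp PP 1 (fun w => X w ord0 j).

Let PP0 := representing_set_neq0 E_repr.
Let H p := E (fun w => dotp p (X w)).

Lemma Lp1_abs_coord j : Lp PP 1 (fun w => `|X w ord0 j|).
Proof.
apply: (@Lp1_l1_lipschitz_comp _ _ PP PP0 m 1 (fun x => `|x ord0 j|) X) => //.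
move=> x y; rewrite mul1r (le_trans (ler_dist_dist _ _))//.
exact: coord_le_l1dist.
Qed.

(** The support function of [Theta] is Lipschitz, so the defining inequalities
    need only be checked in rational directions. *)
Lemma support_le (p q : 'rV[R]_m) e : (forall j, `|q ord0 j - p ord0 j| <= e) ->
  H q <= H p + e * \sum_j E (fun w => `|X w ord0 j|).
Proof.
move=> qp; apply: (E_le_of_means E_repr E_ext (Lp1_dotp E_repr X1 q)) => P PPP.
rewrite (mean_dotp X1 q PPP); set M := mean_rV _ _.
have -> : dotp q M = dotp p M + dotp M (q - p).
  by rewrite dotpBr ![dotp M _]dotpC; ring.
apply: lerD.
  rewrite -(mean_dotp X1 p PPP).
  exact: (mean_le_E E_repr E_ext (Lp1_dotp E_repr X1 p)).
rewrite mulr_sumr; apply: ler_sum => j _.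
rewrite (le_trans (ler_norm _))// normrM mulrC; apply: ler_pM => //.
  by rewrite !mxE.
rewrite mean_rVE; apply: le_trans (mean_le_E E_repr E_ext (Lp1_abs_coord j) PPP).
by apply: le_normr_Rintegral => //; exact: Lp1_integrable (X1 j) PPP.
Qed.

Lemma Theta_of_rational theta :
  (forall q : 'rV[rat]_m, dotp (map_mx ratr q) theta <= H (map_mx ratr q)) ->
  Theta E X theta.
Proof.
move=> Hth p; rewrite -/(H p); apply/ler_addgt0Pr => e e0.
set S := \sum_j E (fun w => `|X w ord0 j|).
have S0 : 0 <= S.
  have [P PPP] := PP0; apply: sumr_ge0 => j _.
  apply: le_trans (mean_le_E E_repr E_ext (Lp1_abs_coord j) PPP).
  exact: Rintegral_ge0.
set N := \sum_j `|theta ord0 j|.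
have N0 : 0 <= N by exact: sumr_ge0.
have D0 : 0 < S + N + 1 by lra.
have [q qp] := rational_approximation p (divr_gt0 e0 D0).
set r := e / _ in qp.
have r0 : 0 < r by exact: divr_gt0.
pose q' : 'rV[R]_m := map_mx ratr q.
have q'p j : `|q' ord0 j - p ord0 j| <= r by rewrite mxE.
have h1 := support_le q'p.
have h2 : dotp theta p - dotp theta q' <= r * N.
  rewrite -dotpBr (le_trans (ler_norm _))// (le_trans (ler_norm_sum _ _ _))//.
  rewrite mulr_sumr; apply: ler_sum => j _; rewrite normrM mulrC !mxE distrC.
  by rewrite ler_wpM2r.
have h3 := Hth q; rewrite dotpC -/q' in h3.
have : r * (S + N) <= e.
  rewrite /r mulrAC ler_pdivrMr// ler_wpM2l ?(ltW e0)//; lra.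
move: h1; rewrite -/S mulrDr; lra.
Qed.

Variable P : probability (borel Omega) R.
Hypothesis PPP : PP P.
Variable C : set (set Omega).
Let G : set (set Omega) := <<s C >>.
Hypothesis G_measurable : G `<=` (measurable : set (set (borel Omega))).
Hypothesis G_step : forall A p, G A ->
  \int[P]_w (\1_A w * dotp p (X w)) <= fine (P A) * H p.

(** On the [G]-event where [<p, Y>] exceeds [H p], the conditional mean would
    have too large an average unless the event is null. *)
Lemma conditional_mean_ae_le (Y : borel Omega -> 'rV[R]_m) p :
  is_cond_expectation_rV P G (X : borel Omega -> _) Y ->
  {ae P, forall w, dotp p (Y w) <= H p}.
Proof.
move=> cY.
have Yi j : P.-integrable [set: borel Omega] (EFin \o (fun w => Y w ord0 j)).
  by have [] := cY j.
have Xi j : P.-integrable [set: borel Omega] (EFin \o (fun w => X w ord0 j)).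
  exact: Lp1_integrable (X1 j) PPP.
have pYG B : measurable B -> G ((fun w => dotp p (Y w)) @^-1` B).
  have mY j : measurable_fun [set: g_sigma_algebraType C]
      (fun w : g_sigma_algebraType C => Y w ord0 j).
    by move=> _ B' mB'; rewrite setTI; have [YG _ _] := cY j; exact: YG.
  have mpY : measurable_fun [set: g_sigma_algebraType C]
      (fun w : g_sigma_algebraType C => dotp p (Y w)).
    apply: measurable_sum => j; apply: measurable_funM => //.
  by move=> mB; have := mpY measurableT B mB; rewrite setTI.
set A := (fun w => dotp p (Y w)) @^-1` `]H p, +oo[%classic.
have GA : G A by exact: pYG.
have mA : measurable (A : set (borel Omega)) := G_measurable GA.
have iA f := @integrable_indic_mul _ (borel Omega) R P A f mA.
have dotp_sum (V : Omega -> 'rV[R]_m) :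
    (forall j, P.-integrable [set: borel Omega] (EFin \o (fun w => V w ord0 j))) ->
    \int[P]_w (\1_A w * dotp p (V w)) =
    \sum_j p ord0 j * \int[P]_(w in A) V w ord0 j.
  move=> Vi.
  have pVi j := integrable_scale (p ord0 j) (iA _ (Vi j)).
  have [_ e] := Rintegral_sum (index_enum 'I_m) pVi.
  transitivity (\int[P]_w \sum_j (p ord0 j * (\1_A w * V w ord0 j))).
    apply: eq_Rintegral => w _; rewrite mulr_sumr; apply: eq_bigr => j _.
    by rewrite mulrCA.
  rewrite e; apply: eq_bigr => j _.
  rewrite [in RHS]Rintegral_indic_mul RintegralZl//.
  exact: iA.
have YX : \int[P]_w (\1_A w * dotp p (Y w)) = \int[P]_w (\1_A w * dotp p (X w)).
  rewrite !dotp_sum//; apply: eq_bigr => j _.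
  by have [_ _ /(_ A GA)] := cY j; rewrite /Rintegral => ->.
have [pYi _] := Rintegral_dotp Yi p.
have ci : P.-integrable [set: borel Omega] (EFin \o (fun _ => H p)).
  exact: (CbLip_integrable P (CbLip_cst Omega (H p))).
pose f w := \1_A w * (dotp p (Y w) - H p).
have fi : P.-integrable [set: borel Omega] (EFin \o f).
  by apply: iA; exact: integrable_sub.
have f0 w : 0 <= f w.
  rewrite /f indicE; case: (boolP (w \in A)) => [/set_mem|_]; last by rewrite mul0r.
  by rewrite /A /= in_itv/= andbT => /ltW; rewrite mul1r subr_ge0.
have fle : \int[P]_w f w <= 0.
  rewrite /f (_ : (\int[P]_w _)%R =
      \int[P]_w (\1_A w * dotp p (Y w) - H p * \1_A w)); last first.
    by apply: eq_Rintegral => w _; ring.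
  rewrite RintegralB//; last 2 first.
  - exact: iA.
  - by apply: integrable_scale; exact: indic_integrable.
  rewrite RintegralZl ?Rintegral_indic//; last exact: indic_integrable.
  by rewrite subr_le0 YX mulrC; exact: G_step.
apply: filterS (ae_eq0_of_mean_le0 fi f0 fle) => w fw.
rewrite leNgt; apply/negP => pH.
have wA : w \in A by rewrite inE /A /= in_itv/= pH.
move: fw; rewrite /f indicE wA mul1r => /eqP; rewrite subr_eq0 => /eqP pE.
by move: pH; rewrite pE ltxx.
Qed.

Lemma conditional_mean_ae_Theta (Y : borel Omega -> 'rV[R]_m) :
  is_cond_expectation_rV P G (X : borel Omega -> _) Y ->
  {ae P, forall w, Theta E X (Y w)}.
Proof.
move=> cY.
pose ok (k : nat) w := if unpickle k is Some q
  then dotp (map_mx ratr (q : 'rV[rat]_m)) (Y w) <= H (map_mx ratr q) else true.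
have ok_ae k : {ae P, forall w, ok k w}.
  rewrite /ok; case: (unpickle k) => [q|]; last exact: aeW.
  exact: conditional_mean_ae_le.
have := ae_foralln ok_ae.
apply: filterS => w okw; apply: Theta_of_rational => q.
by have := okw (pickle q); rewrite /ok pickleK.
Qed.

End conditional_means.

Theorem theorem3p1 (R : realType) (Omega : completeMetricType R)
    (Omega_separable : separable Omega)
    (E : (Omega -> R) -> R) (E_sublinear : regular_sublinear E)
    (PP : set (probability (borel Omega) R))
    (PP_convex : convex_set_of_probabilities PP)
    (PP_compact : weakly_compact PP)
    (E_repr : forall X, CbLip Omega X -> (E X)%:E = upper_expectation PP X)
    (E_ext : L1_extended PP E)
    (d n : nat) (d_ge1 : (1 <= d)%N) (n_gt1 : (1 < n)%N)
    (X : 'I_n -> Omega -> 'rV[R]_d)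
    (X_L2 : forall i, Lp_rV PP 2 (X i))
    (X_indep : independent_sequence E X) :
  (forall i : 'I_n,
     Theta E (X i) = [set mean_rV P (X i : borel Omega -> 'rV[R]_d) | P in PP])
  /\
  (forall (P : probability (borel Omega) R), PP P ->
   forall (i : 'I_n) (Y : borel Omega -> 'rV[R]_d),
     is_cond_expectation_rV P (past_sigma X i) (X i) Y ->
     {ae P, forall w, Theta E (X i) (Y w)}).
Proof.
have PP0 := representing_set_neq0 E_repr.
have X1 i j : Lp PP 1 (fun w => X i w ord0 j) by apply: Lp2_Lp1 => //; exact: X_L2.
split=> [i|P PPP i Y].
  exact: (Theta_means PP_convex PP_compact E_repr E_ext (X1 i)).
have mX k j : measurable_fun [set: borel Omega] (fun w => X k w ord0 j) :=
  (X1 k j).1.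
apply: (conditional_mean_ae_Theta E_repr E_ext (X1 i) PPP) => [A|A p] sA.
  exact: (past_approximable P mX sA).1.
(* Independence constrains the steps with a nonempty past only; for [i = 0] the
   past events are trivial and the inequality is the unconditional one. *)
have [i0|i0] := posnP i; last first.
  have past1 j : Lp PP 1 (fun w => past X i w ord0 j).
    by have [k [l ->]] := past_coord X j; exact: X1.
  exact: (event_mean_dotp_le E_sublinear E_repr E_ext past1 (X1 i)
    (X_indep i i0) PPP (@past_approximable _ _ _ _ X i P mX A sA) p).
have [->|->] : [set B : set Omega | B = set0 \/ B = setT] A.
  move: A sA; apply: smallest_sub => [|B [k []]]; last by rewrite i0.
  split=> [|B [->|->]|F FA].
  - by left.
  - by right; rewrite setD0.
  - by left; rewrite setDv.
  have [[k Fk]|F0] := pselect (exists k, F k = setT).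
    by right; apply/seteqP; split=> // w _; exists k => //; rewrite Fk.
  left; apply: bigcup0 => k _; have [//|Fk] := FA k.
  by exfalso; apply: F0; exists k.
- rewrite measure0 mul0r; under eq_Rintegral do rewrite indic0 mul0r.
  by rewrite Rintegral_cst_prob.
- rewrite probability_setT mul1r; under eq_Rintegral do rewrite indicT mul1r.
  exact: (mean_le_E E_repr E_ext (Lp1_dotp E_repr (X1 i) p)).
Qed.
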